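(* Let $p,q\in\mathbb{C}$, let $\Delta=\sqrt{p^2-4q}$, and for $n\in\mathbb{N}$ let $$R_n(p,q)=\prod_{j=1}^{n}\left\{e^{-p/(2j-1)}\left(1+\frac{p}{2j-1}+\frac{q}{(2j-1)^2}\right)\right\}.$$ Then, as $n\to\infty$, $$R_n(p,q)\sim\frac{2^{-p}\,\pi\, e^{-p\gamma/2}}{\Gamma\left(\frac12+\frac14p+\frac14\Delta\right)\Gamma\left(\frac12+\frac14p-\frac14\Delta\right)}\exp\left(\sum_{j=1}^{\infty}\frac{b_j(p,q)}{(n+\frac12)^j}\right),$$ where the coefficients $b_j(p,q)$ are given by $$b_1(p,q)=\frac18p^2-\frac14q$$ and, for $j\ge2$, $$b_j(p,q)=\frac{pB_j}{2j}+\frac{(-1)^{j+1}\left(B_{j+1}\left(\frac14p+\frac14\Delta\right)+B_{j+1}\left(\frac14p-\frac14\Delta\right)-2B_{j+1}\right)}{j(j+1)}.$$ Thus, as $n\to\infty$, $$R_n(p,q)\sim\frac{2^{-p}\,\pi\, e^{-p\gamma/2}}{\Gamma\left(\frac12+\frac14p+\frac14\Delta\right)\Gamma\left(\frac12+\frac14p-\frac14\Delta\right)}\exp\left(\frac{\frac18p^2-\frac14q}{n+\frac12}+\frac{-\frac1{48}p^3+\frac1{16}pq+\frac1{16}p^2-\frac18q}{(n+\frac12)^2}+\frac{\frac1{192}p^4-\frac1{48}p^2q+\frac1{96}q^2-\frac1{48}p^3+\frac1{16}pq+\frac1{48}p^2-\frac1{24}q}{(n+\frac12)^3}+\cdots\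right).$$
   Context: $\mathbb{N}=\{1,2,3,\ldots\}$. $\gamma=\lim_{n\to\infty}\left(\sum_{k=1}^n\frac1k-\ln n\right)$ is the Euler--Mascheroni constant and $\Gamma$ is the gamma function; the reciprocal $1/\Gamma$ is the usual entire function (equal to $0$ at the poles of $\Gamma$). $\Delta$ denotes either square root of $p^2-4q$ (all expressions are symmetric under $\Delta\mapsto-\Delta$). The Bernoulli polynomials $B_n(t)$ are defined by $\frac{ze^{tz}}{e^z-1}=\sum_{n=0}^\infty B_n(t)\frac{z^n}{n!}$, and the Bernoulli numbers are $B_n=B_n(0)$. The relation $\sim$ denotes an asymptotic expansion in the usual (Poincaré) sense: $F(n)\sim C\exp\left(\sum_{j\ge1}c_j(n+\frac12)^{-j}\right)$ means that for every $N\ge1$, $F(n)=C\exp\left(\sum_{j=1}^{N}c_j(n+\frac12)^{-j}+O(n^{-N-1})\right)$ as $n\to\infty$. The series need not converge. *)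

(* Defs.v *)
From Stdlib Require Import Reals List Factorial.
From Coquelicot Require Import Coquelicot.

Local Open Scope C_scope.

Definition Cexp (z : C) : C :=
  ((exp (Re z) * cos (Im z))%R, (exp (Re z) * sin (Im z))%R).

Definition Cprod (f : nat -> C) (l : list nat) : C :=
  fold_right Cmult (RtoC 1) (map f l).

(* The term of index [k] is [1 + 1/2 + ... + 1/(k+1) - ln (k+1)]. *)
Definition Euler_gamma : R :=
  real (Lim_seq (fun k : nat =>
    (sum_n (fun i : nat => / INR (S i)) k - ln (INR (S k)))%R)).

(* Euler's integral: the integral over (0, +oo) of [t^(z-1) e^(-t) dt], with
   [t^(z-1) = exp ((z-1) ln t)].  Meaningful for [0 < Re z] only. *)
Definition Gamma_integral (z : C) : C :=
  RInt_gen (V := C_R_CompleteNormedModule)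
    (fun t : R => Cexp ((z - 1) * ln t - t)) (at_right 0) (Rbar_locally p_infty).

(* A shift [m] with [0 < Re z + m] (and [m = 0] when [0 < Re z]). *)
Definition Gamma_shift (z : C) : nat := Z.to_nat (up (- Re z)).

(* The entire function 1/Gamma, obtained from Euler's integral through
   [1/Gamma(z) = z (z+1) ... (z+m-1) / Gamma(z+m)]. *)
Definition inv_Gamma (z : C) : C :=
  Cprod (fun k : nat => z + INR k) (seq 0 (Gamma_shift z))
    / Gamma_integral (z + INR (Gamma_shift z)).

(* The Bernoulli polynomials, [B n t] being the value at [t] of the [n]-th one.
   The generating function, extended by 1 at its removable singularity [z = 0],
   has its other poles at the nonzero multiples of [2 i PI].  This determines
   [B] uniquely. *)
Definition is_Bernoulli_polynomials (B : nat -> C -> C) : Prop :=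
  forall t z : C, z <> RtoC 0 -> (Cmod z < 2 * PI)%R ->
    is_series (K := C_AbsRing) (V := C_NormedModule)
      (fun n : nat => B n t * (z ^ n / INR (fact n)))
      (z * Cexp (t * z) / (Cexp z - 1)).

(* [F n ~ K exp (sum_(j >= 1) c j / (n + 1/2)^j)] in the sense of Poincare. *)
Definition exp_asymptotic (F : nat -> C) (K : C) (c : nat -> C) : Prop :=
  forall N : nat, (1 <= N)%nat ->
    exists (E : nat -> C) (M : R),
      eventually (fun n : nat =>
        (Cmod (E n) <= M / INR n ^ (N + 1))%R /\
        F n = K * Cexp (sum_n_m (G := C_AbelianMonoid)
                          (fun j : nat => c j / (INR n + 1 / 2) ^ j) 1 N
                        + E n)).

Definition Rprod (p q : C) (n : nat) : C :=
  Cprod (fun j : nat =>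
           let d : C := RtoC (2 * INR j - 1)%R in
           Cexp (- p / d) * (1 + p / d + q / d ^ 2))
        (seq 1 n).

Definition Rconst (p Delta : C) : C :=
  Cexp (- p * ln 2) * PI * Cexp (- p * Euler_gamma / 2)
    * inv_Gamma (1 / 2 + p / 4 + Delta / 4)
    * inv_Gamma (1 / 2 + p / 4 - Delta / 4).

(* Only the values at [j >= 1] matter. *)
Definition bcoef (B : nat -> C -> C) (p q Delta : C) (j : nat) : C :=
  if Nat.eqb j 1 then p ^ 2 / 8 - q / 4
  else p * B j 0 / (2 * INR j)
       + (- 1) ^ (j + 1)
         * (B (j + 1)%nat (p / 4 + Delta / 4)
            + B (j + 1)%nat (p / 4 - Delta / 4)
            - 2 * B (j + 1)%nat 0)
         / (INR j * (INR j + 1)).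

(* Main.v *)
Require Import Defs.
From Stdlib Require Import ZArith Reals Lra Lia List Factorial.
From Coquelicot Require Import Coquelicot.

(* With u, v = (p +- Delta) / 4 the n-th factor of the product, in terms of
   s = 1 / (n - 1/2), is exp(- (u + v) s) (1 + u s) (1 + v s).  The Bernoulli
   recurrence sum_(k <= m) B_k(t) / (k! (m + 1 - k)!) = t^m / m!, read off from the
   generating function, says that the formal logarithm of this factor telescopes
   as S(n) - S(n - 1), where S(n) is the formal series of the b_j / (n + 1/2)^j.
   With S truncated after N terms the error is O(n^(-N-2)), which is summable with
   tails O(n^(-N-1)); this gives the expansion with the limit of the product as
   leading constant.

   Up to exp(- p (1 + 1/3 + ... + 1 / (2n - 1))) the product is a quotient of
   rising factorials of 1/2 + u, 1/2 + v and 1/2, so its limit follows from Gauss's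
   formula z (z+1) ... (z+n-1) n^(-z) / (n-1)! -> 1 / Gamma(z), Wallis's product and
   the definition of Euler's constant.  Gauss's formula amounts to E[(T/n)^z] -> 1
   for a Gamma(n)-distributed T, which follows from a second order expansion of
   y^z at y = 1 and the integer moments of T. *)

(** * Complex exponential and logarithm *)

Local Open Scope C_scope.

(** No logarithm of the whole product is taken. Principal logarithms serve only single factors of
    large index, which are close to 1; the telescoped sum is exponentiated, and the product stripped
    of it is shown to be eventually constant. Vanishing factors, or a zero of 1/Gamma in the leading
    constant, thus need no separate case. The substitution s -> s / (1 + s) turns 1 / (n - 1/2) into
    1 / (n + 1/2). As s^j - (s / (1 + s))^j starts at order j + 1, N terms can cancel exactly the
    orders up to N + 1. The separate formula for b_1 is a matter of parity: telescoping puts a sign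
    (-1)^j on p B_j / (2 j), which may be dropped for j >= 2 because B_j = 0 for odd j >= 3, but not
    for j = 1. The expansion of y^z goes to second order because a Gamma(n) variable has mean n, so
    that the first order term has expectation 0. Complex calculus is reduced to real and imaginary
    parts, at the price of harmless factors 2. *)

Lemma C_ext (z w : C) : Re z = Re w -> Im z = Im w -> z = w.
Proof. destruct z, w; simpl; intros; subst; reflexivity. Qed.

Lemma Re_plus (z w : C) : Re (z + w) = (Re z + Re w)%R.
Proof. reflexivity. Qed.
Lemma Im_plus (z w : C) : Im (z + w) = (Im z + Im w)%R.
Proof. reflexivity. Qed.
Lemma Re_mult (z w : C) : Re (z * w) = (Re z * Re w - Im z * Im w)%R.
Proof. reflexivity. Qed.
Lemma Im_mult (z w : C) : Im (z * w) = (Re z * Im w + Im z * Re w)%R.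
Proof. reflexivity. Qed.

Lemma Cmod_minus_sym (z w : C) : Cmod (z - w) = Cmod (w - z).
Proof. rewrite <- Cmod_opp; f_equal; ring. Qed.

Lemma im_le_Cmod (z : C) : (Rabs (Im z) <= Cmod z)%R.
Proof.
  eapply Rle_trans; [apply Rmax_r | apply (Rmax_Cmod z)].
Qed.

Lemma Cmod_le_Re_Im (z : C) : (Cmod z <= Rabs (Re z) + Rabs (Im z))%R.
Proof.
  pose proof (Cmod_triangle (RtoC (Re z)) (Ci * RtoC (Im z))) as H.
  replace (RtoC (Re z) + Ci * RtoC (Im z)) with z in H
    by (destruct z; apply C_ext; simpl; unfold Re, Im; simpl; lra).
  rewrite Cmod_mult, Cmod_Ci, !Cmod_R in H; lra.
Qed.

Lemma Cexp_plus (z w : C) : Cexp (z + w) = Cexp z * Cexp w.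
Proof.
  destruct z as [a b], w as [c d]; unfold Cexp; apply C_ext; simpl;
    rewrite exp_plus, ?cos_plus, ?sin_plus; ring.
Qed.

Lemma exp_le (x y : R) : (x <= y)%R -> (exp x <= exp y)%R.
Proof. intros [H | ->]; [left; apply exp_increasing, H | right; reflexivity]. Qed.

Lemma Cexp_RtoC (x : R) : Cexp (RtoC x) = RtoC (exp x).
Proof. unfold Cexp; apply C_ext; simpl; rewrite ?cos_0, ?sin_0; ring. Qed.

Lemma Cexp_0 : Cexp 0 = 1.
Proof. rewrite Cexp_RtoC, exp_0; reflexivity. Qed.

Lemma Cexp_neq_0 (z : C) : Cexp z <> 0.
Proof.
  intros H. apply C1_nz.
  replace (RtoC 1) with (Cexp z * Cexp (- z)).
  - rewrite H; ring.
  - rewrite <- Cexp_plus, <- Cexp_0; f_equal; ring.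
Qed.

Lemma Cexp_opp (z : C) : Cexp (- z) = / Cexp z.
Proof.
  assert (H : Cexp z * Cexp (- z) = 1).
  { rewrite <- Cexp_plus, <- Cexp_0; f_equal; ring. }
  replace (Cexp (- z)) with (/ Cexp z * (Cexp z * Cexp (- z))).
  - rewrite H; ring.
  - field; apply Cexp_neq_0.
Qed.

Lemma Cmod_Cexp (z : C) : Cmod (Cexp z) = exp (Re z).
Proof.
  unfold Cmod, Cexp; simpl.
  replace (_ + _)%R with (exp (Re z) * exp (Re z) * ((sin (Im z))² + (cos (Im z))²))%R
    by (unfold Rsqr; ring).
  rewrite sin2_cos2, Rmult_1_r.
  apply sqrt_square; left; apply exp_pos.
Qed.

(** * Derivatives of complex functions of a real variable, by components *)

Definition is_Cderive (f : R -> C) (x : R) (l : C) : Prop :=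
  is_derive (fun t => Re (f t)) x (Re l) /\ is_derive (fun t => Im (f t)) x (Im l).

Lemma is_Cderive_const (c : C) (x : R) : is_Cderive (fun _ => c) x 0.
Proof. split; simpl; auto_derive; auto. Qed.

Lemma is_Cderive_eq (f : R -> C) (x : R) (l l' : C) :
  is_Cderive f x l -> l = l' -> is_Cderive f x l'.
Proof. intros H <-; exact H. Qed.

Lemma is_Cderive_ext (f g : R -> C) (x : R) (l : C) :
  (forall t, f t = g t) -> is_Cderive f x l -> is_Cderive g x l.
Proof.
  intros E [H1 H2]; split; eapply is_derive_ext; eauto;
    intros; simpl; rewrite E; reflexivity.
Qed.

Lemma is_Cderive_plus (f g : R -> C) (x : R) (lf lg : C) :
  is_Cderive f x lf -> is_Cderive g x lg ->
  is_Cderive (fun t => f t + g t) x (lf + lg).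
Proof.
  intros [H1 H2] [H3 H4]; split.
  - apply (is_derive_plus (V := R_NormedModule) _ _ _ _ _ H1 H3).
  - apply (is_derive_plus (V := R_NormedModule) _ _ _ _ _ H2 H4).
Qed.

Lemma is_Cderive_opp (f : R -> C) (x : R) (l : C) :
  is_Cderive f x l -> is_Cderive (fun t => - f t) x (- l).
Proof.
  intros [H1 H2]; split.
  - apply (is_derive_opp (V := R_NormedModule) _ _ _ H1).
  - apply (is_derive_opp (V := R_NormedModule) _ _ _ H2).
Qed.

Lemma is_Cderive_minus (f g : R -> C) (x : R) (lf lg : C) :
  is_Cderive f x lf -> is_Cderive g x lg ->
  is_Cderive (fun t => f t - g t) x (lf - lg).
Proof. intros H1 H2; apply is_Cderive_plus; [| apply is_Cderive_opp]; assumption. Qed.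

Lemma is_Cderive_mult (f g : R -> C) (x : R) (lf lg : C) :
  is_Cderive f x lf -> is_Cderive g x lg ->
  is_Cderive (fun t => f t * g t) x (lf * g x + f x * lg).
Proof.
  intros [H1 H2] [H3 H4]; split.
  - eapply is_derive_ext; [intros t; symmetry; apply Re_mult |].
    replace (Re _) with ((Re lf * Re (g x) + Re (f x) * Re lg)
       - (Im lf * Im (g x) + Im (f x) * Im lg))%R
      by (rewrite Re_plus, !Re_mult; ring).
    apply (is_derive_minus (V := R_NormedModule)); apply Derive.is_derive_mult; assumption.
  - eapply is_derive_ext; [intros t; symmetry; apply Im_mult |].
    replace (Im _) with ((Re lf * Im (g x) + Re (f x) * Im lg)
       + (Im lf * Re (g x) + Im (f x) * Re lg))%R
      by (rewrite Im_plus, !Im_mult; ring).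
    apply (is_derive_plus (V := R_NormedModule)); apply Derive.is_derive_mult; assumption.
Qed.

Lemma is_Cderive_scal (c : C) (f : R -> C) (x : R) (l : C) :
  is_Cderive f x l -> is_Cderive (fun t => c * f t) x (c * l).
Proof.
  intros H. eapply is_Cderive_eq.
  - apply is_Cderive_mult; [apply is_Cderive_const | exact H].
  - cbv beta; ring.
Qed.

Lemma is_Cderive_RtoC (f : R -> R) (x l : R) :
  is_derive f x l -> is_Cderive (fun t => RtoC (f t)) x (RtoC l).
Proof.
  intros H; split; simpl; [exact H | auto_derive; auto].
Qed.

Lemma is_Cderive_Cexp (f : R -> C) (x : R) (l : C) :
  is_Cderive f x l -> is_Cderive (fun t => Cexp (f t)) x (l * Cexp (f x)).
Proof.
  intros [H1 H2]; split; unfold Cexp, Re, Im in *; simpl.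
  - replace (_ - _)%R with
      ((fst l * exp (fst (f x))) * cos (snd (f x))
       + exp (fst (f x)) * (snd l * - sin (snd (f x))))%R by ring.
    apply (Derive.is_derive_mult (fun t => exp (fst (f t))) (fun t => cos (snd (f t)))).
    + apply (is_derive_comp (V := R_NormedModule) exp (fun t => fst (f t)) x); [apply is_derive_Reals, derivable_pt_lim_exp | exact H1].
    + apply (is_derive_comp (V := R_NormedModule) cos (fun t => snd (f t)) x); [apply is_derive_Reals, derivable_pt_lim_cos | exact H2].
  - replace (_ + _)%R with
      ((fst l * exp (fst (f x))) * sin (snd (f x))
       + exp (fst (f x)) * (snd l * cos (snd (f x))))%R by ring.
    apply (Derive.is_derive_mult (fun t => exp (fst (f t))) (fun t => sin (snd (f t)))).
    + apply (is_derive_comp (V := R_NormedModule) exp (fun t => fst (f t)) x); [apply is_derive_Reals, derivable_pt_lim_exp | exact H1].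
    + apply (is_derive_comp (V := R_NormedModule) sin (fun t => snd (f t)) x); [apply is_derive_Reals, derivable_pt_lim_sin | exact H2].
Qed.

(* The factor 2 comes from applying the mean value theorem to the real and
   imaginary parts separately. *)
Lemma Cderive_bound (f f' : R -> C) (a b M : R) :
  (a <= b)%R ->
  (forall t, (a <= t <= b)%R -> is_Cderive f t (f' t) /\ (Cmod (f' t) <= M)%R) ->
  (Cmod (f b - f a) <= 2 * M * (b - a))%R.
Proof.
  intros Hab H.
  assert (Hcomp : forall (g g' : R -> R),
    (forall t, (a <= t <= b)%R -> is_derive g t (g' t) /\ (Rabs (g' t) <= M)%R) ->
    (Rabs (g b - g a) <= M * (b - a))%R).
  { intros g g' Hg.
    destruct (MVT_gen g a b g') as (c & Hc & E).
    - intros x Hx; rewrite Rmin_left, Rmax_right in Hx by assumption.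
      apply Hg; lra.
    - intros x Hx; rewrite Rmin_left, Rmax_right in Hx by assumption.
      apply continuity_pt_filterlim, (ex_derive_continuous (V := R_NormedModule)).
      exists (g' x); apply Hg; lra.
    - rewrite Rmin_left, Rmax_right in Hc by assumption.
      rewrite E, Rabs_mult, (Rabs_right (b - a)) by lra.
      apply Rmult_le_compat_r; [lra | apply Hg, Hc]. }
  eapply Rle_trans; [apply Cmod_le_Re_Im |].
  replace (2 * M * (b - a))%R with (M * (b - a) + M * (b - a))%R by ring.
  apply Rplus_le_compat.
  - apply (Hcomp (fun t => Re (f t)) (fun t => Re (f' t))).
    intros t Ht; destruct (H t Ht) as [[H1 H2] H3]; split; [exact H1 |].
    eapply Rle_trans; [apply re_le_Cmod | exact H3].
  - apply (Hcomp (fun t => Im (f t)) (fun t => Im (f' t))).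
    intros t Ht; destruct (H t Ht) as [[H1 H2] H3]; split; [exact H2 |].
    eapply Rle_trans; [apply im_le_Cmod | exact H3].
Qed.

(* The principal branch of log (1 + w), for [Re w > -1]. *)
Definition Clog1p (w : C) : C :=
  ((ln ((1 + Re w) ^ 2 + Im w ^ 2) / 2)%R, atan (Im w / (1 + Re w))).

Lemma Cexp_Clog1p (w : C) : (-1 < Re w)%R -> Cexp (Clog1p w) = 1 + w.
Proof.
  destruct w as [a b]; simpl; intros Ha.
  unfold Cexp, Clog1p; simpl.
  set (r2 := ((1 + a) * ((1 + a) * 1) + b * (b * 1))%R).
  assert (Hr : (0 < r2)%R) by (unfold r2; nra).
  (* Inside the logarithms the squared modulus becomes a product, so that half the logarithm is that
     of |1 + w|. *)
  rewrite <- (sqrt_sqrt r2) at 1 2 by lra.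
  assert (Hs : (0 < sqrt r2)%R) by (apply sqrt_lt_R0; exact Hr).
  rewrite ln_mult by assumption.
  replace ((ln (sqrt r2) + ln (sqrt r2)) / 2)%R with (ln (sqrt r2)) by field.
  rewrite exp_ln by assumption.
  (* This is the secant of the argument atan (b / (1 + a)), the quantity that [cos_atan] and
     [sin_atan] produce. *)
  assert (E : sqrt (1 + (b / (1 + a))²) = (sqrt r2 / (1 + a))%R).
  { apply sqrt_lem_1.
    - pose proof (Rle_0_sqr (b / (1 + a))); lra.
    - apply Rlt_le, Rdiv_lt_0_compat; lra.
    - replace (sqrt r2 / (1 + a) * (sqrt r2 / (1 + a)))%R
        with ((sqrt r2 * sqrt r2) / (1 + a) ^ 2)%R by (field; lra).
      rewrite sqrt_sqrt by lra. unfold r2, Rsqr; field; lra. }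
  rewrite cos_atan, sin_atan, E.
  apply C_ext; simpl; field; split; lra.
Qed.

Lemma is_Cderive_Clog1p (u : C) (s : R) :
  (-1 < s * Re u)%R ->
  is_Cderive (fun t => Clog1p (RtoC t * u)) s (u / (1 + RtoC s * u)).
Proof.
  destruct u as [a b]; simpl; intros Hs.
  assert (H0 : (0 < (1 + s * a) ^ 2 + (s * b) ^ 2)%R) by nra.
  assert (H0' : (1 + s * a <> 0)%R) by lra.
  split; simpl.
  - auto_derive.
    + ring_simplify ; nra.
    + field; nra.
  - auto_derive.
    + lra.
    + field. repeat split; nra.
Qed.

(** * Improper integrals over the half-line *)

Local Open Scope R_scope.

Local Notation zero_infty := (filter_prod (at_right 0) (Rbar_locally p_infty)).

Lemma at_right_pos : at_right 0 (fun x => 0 < x).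
Proof. exists (mkposreal 1 Rlt_0_1); intros y _ Hy; exact Hy. Qed.

Lemma p_infty_gt (a : R) : Rbar_locally p_infty (fun x => a < x).
Proof. exists a; auto. Qed.

(** Only intervals around 1 matter for the half-line, so endpoints may be taken positive and
    ordered, and [Rmin], [Rmax] can be evaluated. *)
Lemma zero_infty_ordered :
  zero_infty (fun ab => 0 < fst ab /\ fst ab <= 1 /\ 1 <= snd ab).
Proof.
  apply Filter_prod with (fun x => 0 < x <= 1) (fun x => 1 < x).
  - exists (mkposreal 1 Rlt_0_1); intros y Hy Hy0.
    unfold ball in Hy; simpl in Hy; unfold AbsRing_ball, abs, minus, plus, opp in Hy; simpl in Hy.
    rewrite Ropp_0, Rplus_0_r in Hy; apply Rabs_def2 in Hy; lra.
  - exists 1; auto.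
  - simpl; intros; lra.
Qed.

Lemma ex_RInt_pos (f : R -> R) (a b : R) :
  (forall x, 0 < x -> continuous f x) -> 0 < a -> 0 < b -> ex_RInt f a b.
Proof.
  intros Hf Ha Hb; apply (ex_RInt_continuous (V := R_CompleteNormedModule)).
  intros z [Hz _]; apply Hf.
  eapply Rlt_le_trans; [| exact Hz]; apply Rmin_pos; assumption.
Qed.

Lemma is_RInt_gen_continuous (f : R -> R) (l : R) :
  (forall x, 0 < x -> continuous f x) ->
  filterlim (fun ab => RInt f (fst ab) (snd ab)) zero_infty (locally l) ->
  is_RInt_gen f (at_right 0) (Rbar_locally p_infty) l.
Proof.
  intros Hf Hl P HP; specialize (Hl P HP).
  unfold filtermapi, filtermap in *.
  generalize (filter_and _ _ Hl zero_infty_ordered); apply filter_imp.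
  intros [a b] [H1 H2]; simpl in *.
  exists (RInt f a b); split; [| exact H1].
  apply (RInt_correct (V := R_CompleteNormedModule)), ex_RInt_pos; auto; lra.
Qed.

Lemma RInt_FTC_pos (G g : R -> R) (a b : R) :
  (forall x, 0 < x -> is_derive G x (g x)) -> (forall x, 0 < x -> continuous g x) ->
  0 < a -> 0 < b -> RInt g a b = G b - G a.
Proof.
  intros HG Hg Ha Hb.
  apply is_RInt_unique, (is_RInt_derive (V := R_CompleteNormedModule) G g);
    intros x [Hx _]; assert (0 < x)
      by (eapply Rlt_le_trans; [| exact Hx]; apply Rmin_pos; assumption); auto.
Qed.

Lemma is_RInt_gen_FTC (G g : R -> R) (l0 l1 : R) :
  (forall x, 0 < x -> is_derive G x (g x)) -> (forall x, 0 < x -> continuous g x) ->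
  filterlim G (at_right 0) (locally l0) ->
  filterlim G (Rbar_locally p_infty) (locally l1) ->
  is_RInt_gen g (at_right 0) (Rbar_locally p_infty) (l1 - l0).
Proof.
  intros HG Hg H0 H1.
  apply is_RInt_gen_continuous; [exact Hg |].
  apply filterlim_ext_loc with (fun ab => G (snd ab) - G (fst ab)).
  - generalize zero_infty_ordered; apply filter_imp.
    intros [a b] H; simpl in *; symmetry; apply RInt_FTC_pos; auto; lra.
  - apply (filterlim_comp_2 (fun ab : R * R => G (snd ab)) (fun ab => opp (G (fst ab))) plus
      (filterlim_comp _ _ _ _ _ _ _ _ filterlim_snd H1)
      (filterlim_comp _ _ _ _ _ _ _ _
         (filterlim_comp _ _ _ _ _ _ _ _ filterlim_fst H0)
         (filterlim_opp (V := R_NormedModule) l0))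
      (filterlim_plus (V := R_NormedModule) l1 (opp l0))).
Qed.

(** The endpoints come in either order, hence the absolute value on the right: the Cauchy criterion
    below compares endpoints of unknown order. *)
Lemma RInt_le_primitive (f G g : R -> R) (a b : R) :
  (forall x, 0 < x -> continuous f x) ->
  (forall x, 0 < x -> is_derive G x (g x)) -> (forall x, 0 < x -> continuous g x) ->
  (forall x, 0 < x -> Rabs (f x) <= g x) ->
  0 < a -> 0 < b -> Rabs (RInt f a b) <= Rabs (G b - G a).
Proof.
  intros Hf HG Hg Hfg.
  assert (W : forall a b, 0 < a -> a <= b -> Rabs (RInt f a b) <= Rabs (G b - G a)).
  { intros c d Hc Hcd.
    eapply Rle_trans; [apply abs_RInt_le; [exact Hcd | apply ex_RInt_pos; auto; lra] |].
    rewrite <- (RInt_FTC_pos G g c d) by (auto; lra).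
    eapply Rle_trans; [| apply Rle_abs].
    apply RInt_le; [exact Hcd | | apply ex_RInt_pos; auto; lra | intros x Hx; apply Hfg; lra].
    apply ex_RInt_pos; try lra.
    intros x Hx; apply (continuous_comp f Rabs); [apply Hf, Hx | apply continuous_Rabs]. }
  intros Ha Hb; destruct (Rle_or_lt a b) as [Hab | Hab].
  - apply W; assumption.
  - rewrite <- (opp_RInt_swap (V := R_CompleteNormedModule))
      by (apply ex_RInt_pos; auto).
    unfold opp; simpl; rewrite Rabs_Ropp, Rabs_minus_sym; apply W; lra.
Qed.

(** Cauchy criterion: two integrals differ by the pieces from a' to a and from b to b', each bounded
    by the oscillation of [G] near one end. Endpoints within eps/4 of the limits of [G] make each
    oscillation less than eps/2. *)
Lemma ex_RInt_gen_dominated (f G g : R -> R) (l0 l1 : R) :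
  (forall x, 0 < x -> continuous f x) ->
  (forall x, 0 < x -> is_derive G x (g x)) -> (forall x, 0 < x -> continuous g x) ->
  (forall x, 0 < x -> Rabs (f x) <= g x) ->
  filterlim G (at_right 0) (locally l0) ->
  filterlim G (Rbar_locally p_infty) (locally l1) ->
  exists l, is_RInt_gen f (at_right 0) (Rbar_locally p_infty) l.
Proof.
  intros Hf HG Hg Hfg H0 H1.
  enough (exists l, filterlim (fun ab => RInt f (fst ab) (snd ab)) zero_infty (locally l))
    as [l Hl] by (exists l; apply is_RInt_gen_continuous; assumption).
  apply (filterlim_locally_cauchy (U := R_CompleteNormedModule)).
  intros eps.
  assert (He : 0 < eps / 4) by (pose proof (cond_pos eps); lra).
  assert (B0 : at_right 0 (fun x => Rabs (G x - l0) < eps / 4)).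
  { apply (H0 (fun y => Rabs (y - l0) < eps / 4)).
    exists (mkposreal _ He); intros y Hy; exact Hy. }
  assert (B1 : Rbar_locally p_infty (fun x => Rabs (G x - l1) < eps / 4)).
  { apply (H1 (fun y => Rabs (y - l1) < eps / 4)).
    exists (mkposreal _ He); intros y Hy; exact Hy. }
  exists (fun ab => (0 < fst ab /\ Rabs (G (fst ab) - l0) < eps / 4)
                 /\ (0 < snd ab /\ Rabs (G (snd ab) - l1) < eps / 4)).
  split.
  - econstructor.
    + exact (filter_and _ _ at_right_pos B0).
    + exact (filter_and _ _ (p_infty_gt 0) B1).
    + simpl; auto.
  - intros [a b] [a' b'] [[Ha Ka] [Hb Kb]] [[Ha' Ka'] [Hb' Kb']]; simpl in *.
    unfold ball; simpl; unfold AbsRing_ball, abs, minus, plus, opp; simpl.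
    replace (RInt f a' b' + - RInt f a b) with (RInt f a' a + RInt f b b').
    2:{ rewrite <- (RInt_Chasles (V := R_CompleteNormedModule) f a' a b') by (apply ex_RInt_pos; auto).
        rewrite <- (RInt_Chasles (V := R_CompleteNormedModule) f a b b') by (apply ex_RInt_pos; auto).
        unfold plus; simpl; ring. }
    eapply Rle_lt_trans; [apply Rabs_triang |].
    pose proof (RInt_le_primitive f G g a' a Hf HG Hg Hfg Ha' Ha) as P.
    pose proof (RInt_le_primitive f G g b b' Hf HG Hg Hfg Hb Hb') as Q.
    assert (Rabs (G a - G a') < eps / 2).
    { replace (G a - G a') with ((G a - l0) - (G a' - l0)) by ring.
      eapply Rle_lt_trans; [apply Rabs_triang |]; rewrite Rabs_Ropp; lra. }
    assert (Rabs (G b' - G b) < eps / 2).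
    { replace (G b' - G b) with ((G b' - l1) - (G b - l1)) by ring.
      eapply Rle_lt_trans; [apply Rabs_triang |]; rewrite Rabs_Ropp; lra. }
    lra.
Qed.

(** * Complex integrals over the half-line, by components *)

Definition is_Cint (f : R -> C) (l : C) : Prop :=
  is_RInt_gen (fun t => Re (f t)) (at_right 0) (Rbar_locally p_infty) (Re l) /\
  is_RInt_gen (fun t => Im (f t)) (at_right 0) (Rbar_locally p_infty) (Im l).

Lemma is_Cint_RInt_gen (f : R -> C) (l : C) :
  is_Cint f l ->
  RInt_gen (V := C_R_CompleteNormedModule) f (at_right 0) (Rbar_locally p_infty) = l.
Proof.
  intros [H1 H2].
  apply is_RInt_gen_unique; try apply Proper_StrongProper; try typeclasses eauto.
  intros P [eps HP].
  specialize (H1 (ball (Re l) eps) (locally_ball _ _)).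
  specialize (H2 (ball (Im l) eps) (locally_ball _ _)).
  unfold filtermapi in *.
  generalize (filter_and _ _ H1 H2); apply filter_imp.
  intros [a b] [[x [Hx Bx]] [y [Hy By]]]; simpl in *.
  exists (x, y); split.
  - apply (is_RInt_fct_extend_pair (U := R_NormedModule) (V := R_NormedModule) f a b x y); assumption.
  - apply HP; split; assumption.
Qed.

Lemma is_RInt_gen_ext_pos (f g : R -> R) (l : R) :
  (forall t, 0 < t -> f t = g t) ->
  is_RInt_gen f (at_right 0) (Rbar_locally p_infty) l ->
  is_RInt_gen g (at_right 0) (Rbar_locally p_infty) l.
Proof.
  intros E; apply is_RInt_gen_ext.
  generalize zero_infty_ordered; apply filter_imp.
  intros [a b] H x [Hx _]; simpl in *; apply E.
  rewrite Rmin_left in Hx; lra.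
Qed.

Lemma is_Cint_ext (f g : R -> C) (l : C) :
  (forall t, 0 < t -> f t = g t) -> is_Cint f l -> is_Cint g l.
Proof.
  intros E [H1 H2]; split; eapply is_RInt_gen_ext_pos; eauto;
    intros t Ht; simpl; rewrite E; auto.
Qed.

Lemma is_RInt_gen_lin (f g : R -> R) (a b lf lg : R) :
  is_RInt_gen f (at_right 0) (Rbar_locally p_infty) lf ->
  is_RInt_gen g (at_right 0) (Rbar_locally p_infty) lg ->
  is_RInt_gen (fun t => a * f t + b * g t) (at_right 0) (Rbar_locally p_infty)
    (a * lf + b * lg).
Proof.
  intros H1 H2.
  apply (is_RInt_gen_plus (V := R_NormedModule) (fun t => a * f t) (fun t => b * g t) (a * lf) (b * lg)).
  - apply (is_RInt_gen_scal (V := R_NormedModule) f a lf H1).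
  - apply (is_RInt_gen_scal (V := R_NormedModule) g b lg H2).
Qed.

Lemma is_Cint_plus (f g : R -> C) (lf lg : C) :
  is_Cint f lf -> is_Cint g lg -> is_Cint (fun t => f t + g t)%C (lf + lg)%C.
Proof.
  intros [H1 H2] [H3 H4]; split.
  - apply (is_RInt_gen_plus (V := R_NormedModule) (fun t => Re (f t)) (fun t => Re (g t)) (Re lf) (Re lg)); assumption.
  - apply (is_RInt_gen_plus (V := R_NormedModule) (fun t => Im (f t)) (fun t => Im (g t)) (Im lf) (Im lg)); assumption.
Qed.

Lemma is_Cint_scal (c : C) (f : R -> C) (l : C) :
  is_Cint f l -> is_Cint (fun t => c * f t)%C (c * l)%C.
Proof.
  intros [H1 H2]; split.
  - eapply is_RInt_gen_ext_pos; [| rewrite Re_mult; unfold Rminus].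
    + intros t _; symmetry; rewrite Re_mult; unfold Rminus.
      rewrite Ropp_mult_distr_l; reflexivity.
    + rewrite Ropp_mult_distr_l; apply is_RInt_gen_lin; assumption.
  - eapply is_RInt_gen_ext_pos; [| rewrite Im_mult].
    + intros t _; symmetry; apply Im_mult.
    + apply (is_RInt_gen_lin (fun t => Im (f t)) (fun t => Re (f t))); assumption.
Qed.

Lemma is_Cint_unique (f : R -> C) (l l' : C) : is_Cint f l -> is_Cint f l' -> l = l'.
Proof. intros H H'; rewrite <- (is_Cint_RInt_gen f l H); apply is_Cint_RInt_gen, H'. Qed.

(** Real and imaginary parts are bounded separately, whence the factor 2; the bound only feeds a
    limit equal to 0. *)
Lemma is_Cint_bound (f : R -> C) (h : R -> R) (l : C) (r : R) :
  (forall t, 0 < t -> Cmod (f t) <= h t) -> is_Cint f l ->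
  is_RInt_gen h (at_right 0) (Rbar_locally p_infty) r -> Cmod l <= 2 * r.
Proof.
  intros Hb [H1 H2] Hr.
  assert (B : forall (g : R -> R) lg, (forall t, 0 < t -> Rabs (g t) <= h t) ->
     is_RInt_gen g (at_right 0) (Rbar_locally p_infty) lg -> Rabs lg <= r).
  { intros g lg Hg Hlg.
    apply (RInt_gen_norm (V := R_CompleteNormedModule) (Fa := at_right 0) (Fb := Rbar_locally p_infty) g h lg r); auto.
    - generalize zero_infty_ordered; apply filter_imp; intros [a b] H; simpl in *; lra.
    - generalize zero_infty_ordered; apply filter_imp; intros [a b] H x Hx; simpl in *.
      apply Hg; lra. }
  eapply Rle_trans; [apply Cmod_le_Re_Im |].
  pose proof (B _ _ (fun t Ht => Rle_trans _ _ _ (re_le_Cmod (f t)) (Hb t Ht)) H1).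
  pose proof (B _ _ (fun t Ht => Rle_trans _ _ _ (im_le_Cmod (f t)) (Hb t Ht)) H2).
  lra.
Qed.

(** * Euler's integral *)

Lemma is_Cderive_continuous (f : R -> C) (x : R) (l : C) :
  is_Cderive f x l ->
  continuous (fun t => Re (f t)) x /\ continuous (fun t => Im (f t)) x.
Proof.
  intros [H1 H2]; split; apply (ex_derive_continuous (V := R_NormedModule));
    [exists (Re l) | exists (Im l)]; assumption.
Qed.

Lemma filterlim_0 {T : Type} (F : (T -> Prop) -> Prop) {FF : Filter F} (f : T -> R) :
  (forall eps, 0 < eps -> F (fun x => Rabs (f x) < eps)) -> filterlim f F (locally 0).
Proof.
  intros H P [eps HP]; unfold filtermap.
  generalize (H eps (cond_pos eps)); apply filter_imp.
  intros x Hx; apply HP; unfold ball; simpl; unfold AbsRing_ball, abs, minus, plus, opp; simpl.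
  rewrite Ropp_0, Rplus_0_r; exact Hx.
Qed.

Lemma is_Cint_FTC (F f : R -> C) (l0 l1 : C) :
  (forall x, 0 < x -> is_Cderive F x (f x)) ->
  (forall x, 0 < x -> exists l, is_Cderive f x l) ->
  (forall eps, 0 < eps -> at_right 0 (fun x => Cmod (F x - l0) < eps)) ->
  (forall eps, 0 < eps -> Rbar_locally p_infty (fun x => Cmod (F x - l1) < eps)) ->
  is_Cint f (l1 - l0)%C.
Proof.
  intros HF Hf H0 H1.
  assert (L : forall (pr : C -> R) (FF : (R -> Prop) -> Prop) (HFF : Filter FF) (l : C),
    (forall z w, pr (z - w)%C = pr z - pr w) -> (forall z, Rabs (pr z) <= Cmod z) ->
    (forall eps, 0 < eps -> FF (fun x => Cmod (F x - l) < eps)) ->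
    filterlim (fun t => pr (F t)) FF (locally (pr l))).
  { intros pr FF HFF l Hpr Hle H P [eps HP]; unfold filtermap.
    generalize (H eps (cond_pos eps)); apply filter_imp.
    intros x Hx; apply HP; unfold ball; simpl; unfold AbsRing_ball, abs, minus, plus, opp; simpl.
    fold (Rminus (pr (F x)) (pr l)); rewrite <- Hpr.
    eapply Rle_lt_trans; [apply Hle | exact Hx]. }
  split; [replace (Re (l1 - l0)) with (Re l1 - Re l0) by reflexivity
         | replace (Im (l1 - l0)) with (Im l1 - Im l0) by reflexivity].
  - apply is_RInt_gen_FTC with (fun t => Re (F t)).
    + intros x Hx; apply (HF x Hx).
    + intros x Hx; destruct (Hf x Hx) as [l Hl]; apply (is_Cderive_continuous _ _ _ Hl).
    + apply (L Re); auto using re_le_Cmod. typeclasses eauto.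
    + apply (L Re); auto using re_le_Cmod. typeclasses eauto.
  - apply is_RInt_gen_FTC with (fun t => Im (F t)).
    + intros x Hx; apply (HF x Hx).
    + intros x Hx; destruct (Hf x Hx) as [l Hl]; apply (is_Cderive_continuous _ _ _ Hl).
    + apply (L Im); auto using im_le_Cmod. typeclasses eauto.
    + apply (L Im); auto using im_le_Cmod. typeclasses eauto.
Qed.

Definition gamma_kernel (z : C) (t : R) : C := Cexp ((z - 1) * ln t - t).

(** Used with w = z - 1 for the kernel of Euler's integral and with w = z for the boundary term t^z
    e^(-t). *)
Lemma is_Cderive_log_exponent (w : C) (t : R) : 0 < t ->
  is_Cderive (fun t => Cexp (w * ln t - t)) t ((w / t - 1) * Cexp (w * ln t - t))%C.
Proof.
  intros Ht; apply (is_Cderive_Cexp (fun t => w * ln t - t)%C).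
  eapply is_Cderive_eq.
  - apply is_Cderive_minus.
    + apply is_Cderive_scal, is_Cderive_RtoC, is_derive_Reals, derivable_pt_lim_ln, Ht.
    + apply is_Cderive_RtoC, (is_derive_id (K := R_AbsRing)).
  - rewrite RtoC_inv by lra; reflexivity.
Qed.

Lemma gamma_kernel_succ (z : C) (t : R) : 0 < t ->
  gamma_kernel (z + 1) t = (t * gamma_kernel z t)%C.
Proof.
  intros Ht; unfold gamma_kernel.
  replace (RtoC t) with (Cexp (ln t)) at 2 by (rewrite Cexp_RtoC, exp_ln; auto).
  rewrite <- Cexp_plus; f_equal; ring.
Qed.

Lemma Cmod_gamma_kernel (z : C) (t : R) :
  Cmod (gamma_kernel z t) = exp ((Re z - 1) * ln t - t).
Proof.
  unfold gamma_kernel; rewrite Cmod_Cexp; f_equal.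
  destruct z; simpl; ring.
Qed.

Lemma ln_le_sub_1 (y : R) : 0 < y -> ln y <= y - 1.
Proof.
  intros Hy; pose proof (exp_ineq1_le (ln y)) as H; rewrite exp_ln in H by exact Hy; lra.
Qed.

(** The concave function s ln t lies below its tangent at t = 2 s, whose slope is 1/2. *)
Lemma power_le_exp_half (s : R) : 0 < s ->
  exists c, forall t, 0 < t -> s * ln t <= t / 2 + c.
Proof.
  intros Hs; exists (s * (ln (2 * s) - 1)); intros t Ht.
  pose proof (ln_le_sub_1 (t / (2 * s))) as H.
  assert (0 < t / (2 * s)) by (apply Rdiv_lt_0_compat; lra).
  rewrite ln_div in H by lra.
  replace (t / 2 + s * (ln (2 * s) - 1)) with (s * (t / (2 * s) - 1 + ln (2 * s))) by (field; lra).
  apply Rmult_le_compat_l; lra.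
Qed.

Lemma power_small_0 (s eps : R) : 0 < s -> 0 < eps ->
  at_right 0 (fun t => exp (s * ln t) < eps).
Proof.
  intros Hs He; exists (mkposreal _ (exp_pos (ln eps / s))); intros t Ht Ht0.
  unfold ball in Ht; simpl in Ht; unfold AbsRing_ball, abs, minus, plus, opp in Ht; simpl in Ht.
  rewrite Ropp_0, Rplus_0_r, Rabs_right in Ht by lra.
  rewrite <- (exp_ln eps) by exact He.
  apply ln_increasing in Ht; [| exact Ht0].
  apply exp_increasing; rewrite ln_exp in Ht.
  replace (ln eps) with (s * (ln eps / s)) by (field; lra).
  apply Rmult_lt_compat_l; assumption.
Qed.

Lemma gamma_boundary_0 (z : C) (eps : R) : 0 < Re z -> 0 < eps ->
  at_right 0 (fun t => Cmod (Cexp (z * ln t - t) - 0) < eps).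
Proof.
  intros Hz He; generalize (filter_and _ _ (power_small_0 _ _ Hz He) at_right_pos).
  apply filter_imp; intros t [Ht H0].
  replace (Cexp (z * ln t - t) - 0)%C with (Cexp (z * ln t - t)) by ring.
  rewrite Cmod_Cexp; eapply Rle_lt_trans; [| exact Ht].
  replace (Re (z * ln t - t)) with (Re z * ln t - t) by (destruct z; simpl; ring).
  apply exp_le; lra.
Qed.

Lemma gamma_boundary_infty (z : C) (eps : R) : 0 < Re z -> 0 < eps ->
  Rbar_locally p_infty (fun t => Cmod (Cexp (z * ln t - t) - 0) < eps).
Proof.
  intros Hz He; destruct (power_le_exp_half _ Hz) as [c Hc].
  exists (Rmax 0 (2 * (c - ln eps))); intros t Ht.
  assert (0 < t) by (eapply Rle_lt_trans; [apply Rmax_l | exact Ht]).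
  assert (H2 : 2 * (c - ln eps) < t) by (eapply Rle_lt_trans; [apply Rmax_r | exact Ht]).
  replace (Cexp (z * ln t - t) - 0)%C with (Cexp (z * ln t - t)) by ring.
  rewrite Cmod_Cexp, <- (exp_ln eps) by exact He.
  replace (Re (z * ln t - t)) with (Re z * ln t - t) by (destruct z; simpl; ring).
  apply exp_increasing; specialize (Hc t H); lra.
Qed.

(** The majorant is chosen for its elementary primitive M x^s / (1 + x^s), which has finite limits
    at both ends; its derivative behaves like x^(s-1) at 0 and like x^(-s-1) at infinity. *)
Lemma gamma_kernel_dominated (s : R) : 0 < s -> exists (g G : R -> R) (M : R),
  (forall x, 0 < x -> is_derive G x (g x)) /\ (forall x, 0 < x -> continuous g x) /\
  (forall x, 0 < x -> exp ((s - 1) * ln x - x) <= g x) /\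
  filterlim G (at_right 0) (locally 0) /\ filterlim G (Rbar_locally p_infty) (locally M).
Proof.
  intros Hs; destruct (power_le_exp_half s Hs) as [c Hc].
  (* [K] bounds (1 + x^s) e^(-x/2); its square therefore bounds (1 + x^s)^2 e^(-x), which is the
     required domination. *)
  set (K := 1 + exp c); assert (HK : 0 < K) by (unfold K; pose proof (exp_pos c); lra).
  set (M := K ^ 2 / s).
  assert (HM : 0 < M) by (unfold M; apply Rdiv_lt_0_compat; [apply pow_lt |]; lra).
  exists (fun x => M * s / x * exp (s * ln x) / (1 + exp (s * ln x)) ^ 2),
    (fun x => M * (1 - / (1 + exp (s * ln x)))), M.
  assert (P : forall x, 0 < exp (s * ln x)) by (intros; apply exp_pos).
  split; [| split; [| split; [| split]]].
  - intros x Hx; pose proof (P x); auto_derive; [repeat split; lra |].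
    field; repeat split; lra.
  - intros x Hx; pose proof (P x); apply (ex_derive_continuous (V := R_NormedModule)).
    auto_derive; repeat split; try lra. apply Rgt_not_eq; nra.
  - intros x Hx.
    replace (exp ((s - 1) * ln x - x)) with (exp (s * ln x) / x * exp (- x)).
    2:{ replace ((s - 1) * ln x - x) with (s * ln x + - ln x + - x) by ring.
        rewrite !exp_plus, (exp_Ropp (ln x)), exp_ln by exact Hx; field; lra. }
    pose proof (P x) as He.
    replace (M * s / x * exp (s * ln x) / (1 + exp (s * ln x)) ^ 2)
      with (exp (s * ln x) / x * (K ^ 2 / (1 + exp (s * ln x)) ^ 2))
      by (unfold M; field; repeat split; lra).
    apply Rmult_le_compat_l; [apply Rlt_le, Rdiv_lt_0_compat; lra |].
    apply Rmult_le_reg_r with ((1 + exp (s * ln x)) ^ 2); [apply pow_lt; lra |].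
    replace (K ^ 2 / (1 + exp (s * ln x)) ^ 2 * (1 + exp (s * ln x)) ^ 2) with (K ^ 2)
      by (field; lra).
    replace (exp (- x)) with (exp (- (x / 2)) ^ 2)
      by (simpl; rewrite Rmult_1_r, <- exp_plus; f_equal; field).
    rewrite <- Rpow_mult_distr; apply pow_incr; split.
    { apply Rmult_le_pos; [apply Rlt_le, exp_pos | lra]. }
    rewrite Rmult_plus_distr_l, <- exp_plus, Rmult_1_r; unfold K; apply Rplus_le_compat.
    + rewrite <- exp_0; apply exp_le; lra.
    + apply exp_le; specialize (Hc x Hx); lra.
  - apply filterlim_0; [typeclasses eauto |]; intros eps He.
    assert (He' : 0 < eps / M) by (apply Rdiv_lt_0_compat; lra).
    generalize (power_small_0 s (eps / M) Hs He'); apply filter_imp; intros x Hx.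
    pose proof (P x) as Hp.
    replace (1 - / (1 + exp (s * ln x))) with (exp (s * ln x) / (1 + exp (s * ln x)))
      by (field; lra).
    assert (Hq : 0 < / (1 + exp (s * ln x)) <= 1).
    { split; [apply Rinv_0_lt_compat; lra |].
      rewrite <- Rinv_1 at 2; apply Rinv_le_contravar; lra. }
    rewrite Rabs_right by (unfold Rdiv; apply Rle_ge; apply Rmult_le_pos; [lra | apply Rmult_le_pos; lra]).
    apply Rle_lt_trans with (M * exp (s * ln x)).
    + apply Rmult_le_compat_l; [lra |]; unfold Rdiv.
      rewrite <- (Rmult_1_r (exp (s * ln x))) at 3; apply Rmult_le_compat_l; lra.
    + replace eps with (M * (eps / M)) by (field; lra); apply Rmult_lt_compat_l; lra.
  (* Beyond this point x^s > M / eps, so that [M] exceeds the primitive by less than eps. *)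
  - intros Q [eps HQ]; exists (exp (- ln (eps / M) / s)); intros x Hx; apply HQ.
    assert (He : 0 < eps / M) by (apply Rdiv_lt_0_compat; [apply cond_pos | lra]).
    unfold ball; simpl; unfold AbsRing_ball, abs, minus, plus, opp; simpl.
    pose proof (P x) as Hp.
    replace (M * (1 - / (1 + exp (s * ln x))) + - M) with (- (M * / (1 + exp (s * ln x)))) by ring.
    assert (0 < / (1 + exp (s * ln x))) by (apply Rinv_0_lt_compat; lra).
    rewrite Rabs_Ropp, Rabs_right by (apply Rle_ge, Rmult_le_pos; lra).
    assert (Hx0 : 0 < x) by (eapply Rlt_trans; [apply exp_pos | exact Hx]).
    assert (Hl : - ln (eps / M) < s * ln x).
    { apply ln_increasing in Hx; [| apply exp_pos]; rewrite ln_exp in Hx.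
      replace (- ln (eps / M)) with (s * (- ln (eps / M) / s)) by (field; lra).
      apply Rmult_lt_compat_l; lra. }
    apply exp_increasing in Hl; rewrite exp_Ropp, exp_ln in Hl by exact He.
    replace (pos eps) with (M * (eps / M)) by (field; lra).
    apply Rmult_lt_compat_l; [exact HM |].
    rewrite <- (Rinv_inv (eps / M)); apply Rinv_lt_contravar; [| lra].
    apply Rmult_lt_0_compat; [apply Rinv_0_lt_compat, He | lra].
Qed.

Lemma is_Cint_gamma_kernel (z : C) : 0 < Re z ->
  is_Cint (gamma_kernel z) (Gamma_integral z).
Proof.
  intros Hz.
  destruct (gamma_kernel_dominated _ Hz) as (g & G & M & HG & Hg & Hle & H0 & H1).
  assert (HK : forall x, 0 < x -> continuous (fun t => Re (gamma_kernel z t)) x /\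
    continuous (fun t => Im (gamma_kernel z t)) x).
  { intros x Hx; eapply is_Cderive_continuous, is_Cderive_log_exponent, Hx. }
  assert (Hb : forall x, 0 < x -> Cmod (gamma_kernel z x) <= g x).
  { intros x Hx; rewrite Cmod_gamma_kernel; apply Hle, Hx. }
  destruct (ex_RInt_gen_dominated (fun t => Re (gamma_kernel z t)) G g 0 M) as [l1 Hl1];
    auto.
  { intros x Hx; apply (proj1 (HK x Hx)). }
  { intros x Hx; eapply Rle_trans; [apply re_le_Cmod | auto]. }
  destruct (ex_RInt_gen_dominated (fun t => Im (gamma_kernel z t)) G g 0 M) as [l2 Hl2];
    auto.
  { intros x Hx; apply (proj2 (HK x Hx)). }
  { intros x Hx; eapply Rle_trans; [apply im_le_Cmod | auto]. }
  assert (H : is_Cint (gamma_kernel z) (l1, l2)) by (split; assumption).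
  unfold Gamma_integral; fold (gamma_kernel z).
  rewrite (is_Cint_RInt_gen _ _ H); exact H.
Qed.

(** Integration by parts: [f] is the derivative of t^z e^(-t), which tends to 0 at both ends, and it
    is also the difference of the two integrands. *)
Lemma Gamma_integral_succ (z : C) : 0 < Re z ->
  Gamma_integral (z + 1) = (z * Gamma_integral z)%C.
Proof.
  intros Hz.
  assert (Hz1 : 0 < Re (z + 1)) by (destruct z; simpl in *; lra).
  set (f := fun t : R => ((z / t - 1) * Cexp (z * ln t - t))%C).
  assert (H : is_Cint f (0 - 0)%C).
  { apply is_Cint_FTC with (fun t => Cexp (z * ln t - t)).
    - intros x Hx; apply is_Cderive_log_exponent, Hx.
    - intros x Hx; eexists; unfold f. apply is_Cderive_mult.
      + apply is_Cderive_minus; [| apply is_Cderive_const].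
        apply is_Cderive_ext with (fun t => z * RtoC (/ t))%C.
        * intros t; unfold Cdiv; f_equal.
          (* The extensionality lemma asks for equality at every t; at t = 0 the real and the
             complex inverse both have the default value 0. *)
          destruct (Req_dec t 0) as [-> |].
          -- rewrite Rinv_0; apply C_ext; simpl; unfold Rdiv; rewrite ?Rmult_0_l, ?Rmult_0_r; auto; ring.
          -- apply RtoC_inv; assumption.
        * apply is_Cderive_scal, is_Cderive_RtoC.
          auto_derive; [apply Rgt_not_eq, Hx | reflexivity].
      + apply is_Cderive_log_exponent, Hx.
    - intros; apply gamma_boundary_0; assumption.
    - intros; apply gamma_boundary_infty; assumption. }
  pose proof (is_Cint_plus _ _ _ _ H (is_Cint_gamma_kernel _ Hz1)) as H'.
  pose proof (is_Cint_scal z _ _ (is_Cint_gamma_kernel _ Hz)) as H''.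
  cut ((0 - 0) + Gamma_integral (z + 1) = z * Gamma_integral z)%C.
  { intros E; rewrite <- E; ring. }
  apply (is_Cint_unique _ _ _ H'); eapply is_Cint_ext; [| exact H''].
  intros t Ht; unfold f; simpl.
  rewrite gamma_kernel_succ by exact Ht.
  replace (Cexp (z * ln t - t)) with (t * gamma_kernel z t)%C.
  - field; intros E; apply RtoC_inj in E; lra.
  - rewrite <- gamma_kernel_succ by exact Ht; unfold gamma_kernel; f_equal; ring.
Qed.

Lemma Gamma_integral_1 : Gamma_integral 1 = 1.
Proof.
  assert (H : is_Cint (gamma_kernel 1) (0 - (- 1))%C).
  { apply is_Cint_FTC with (fun t => (- RtoC (exp (- t)))%C).
    - intros x Hx; eapply is_Cderive_eq.
      + apply is_Cderive_opp, is_Cderive_RtoC; auto_derive; [auto | reflexivity].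
      + unfold gamma_kernel; replace ((1 - 1) * ln x - x)%C with (RtoC (- x))
          by (rewrite RtoC_opp; ring).
        rewrite Cexp_RtoC, <- RtoC_opp; f_equal; ring.
    - intros x Hx; eexists; apply is_Cderive_log_exponent, Hx.
    - intros eps He.
      exists (mkposreal _ He); intros t Ht Ht0.
      unfold ball in Ht; simpl in Ht; unfold AbsRing_ball, abs, minus, plus, opp in Ht; simpl in Ht.
      rewrite Ropp_0, Rplus_0_r, Rabs_right in Ht by lra.
      match goal with |- Cmod ?w < _ => replace w with (RtoC (1 - exp (- t)))
        by (rewrite RtoC_minus; ring) end.
      rewrite Cmod_R.
      pose proof (exp_ineq1_le (- t)).
      assert (exp (- t) < exp 0) by (apply exp_increasing; lra).
      rewrite exp_0 in *; rewrite Rabs_right; lra.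
    - intros eps He; exists (- ln eps); intros t Ht.
      match goal with |- Cmod ?w < _ => replace w with (- RtoC (exp (- t)))%C by ring end.
      rewrite Cmod_opp, Cmod_R, Rabs_right by (left; apply exp_pos).
      rewrite <- (exp_ln eps) by exact He; apply exp_increasing; lra. }
  rewrite (is_Cint_unique _ _ _ (is_Cint_gamma_kernel 1 (Rlt_0_1)) H); ring.
Qed.

Lemma Gamma_integral_nat (n : nat) : Gamma_integral (INR n + 1) = INR (fact n).
Proof.
  induction n as [| n IH].
  - replace (INR 0 + 1)%C with (RtoC 1) by (simpl; ring); apply Gamma_integral_1.
  - rewrite Gamma_integral_succ by (simpl Re; apply (lt_0_INR (S n)); lia).
    rewrite S_INR, RtoC_plus, IH, <- RtoC_plus, <- S_INR, <- RtoC_mult, <- mult_INR.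
    reflexivity.
Qed.

Lemma is_RInt_gen_gamma_moment (n : nat) :
  is_RInt_gen (fun t => t ^ n * exp (- t)) (at_right 0) (Rbar_locally p_infty) (INR (fact n)).
Proof.
  assert (H : 0 < Re (INR n + 1)) by (simpl; pose proof (pos_INR n); lra).
  pose proof (proj1 (is_Cint_gamma_kernel _ H)) as Hi.
  rewrite Gamma_integral_nat, re_RtoC in Hi.
  eapply is_RInt_gen_ext_pos; [| exact Hi].
  intros t Ht; unfold gamma_kernel.
  replace ((INR n + 1 - 1) * ln t - t)%C with (RtoC (INR n * ln t + - t))
    by (rewrite RtoC_plus, RtoC_mult, RtoC_opp; ring).
  rewrite Cexp_RtoC, re_RtoC, exp_plus, <- Rpower_pow by exact Ht; reflexivity.
Qed.

(** * Gauss's product *)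

(** This is n! times the expectation of (T/N - 1)^2 (T/N)^j for a Gamma(N)-distributed T; expanding
    the square leaves three integer moments. *)
Lemma is_RInt_gen_gamma_shifted_square (n j : nat) :
  let N := INR (S n) in
  is_RInt_gen (fun t => (t / N - 1) ^ 2 * (t / N) ^ j * (t ^ n * exp (- t)))
    (at_right 0) (Rbar_locally p_infty)
    (INR (fact (n + j + 2)) / N ^ (j + 2) - 2 * (INR (fact (n + j + 1)) / N ^ (j + 1))
     + INR (fact (n + j)) / N ^ j).
Proof.
  intros N.
  assert (HN : N <> 0) by (apply not_0_INR; lia).
  assert (HNj : N ^ j <> 0) by (apply pow_nonzero, HN).
  pose proof (is_RInt_gen_lin _ _ (/ N ^ (j + 2)) (- 2 / N ^ (j + 1)) _ _
    (is_RInt_gen_gamma_moment (n + j + 2)) (is_RInt_gen_gamma_moment (n + j + 1))) as H1.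
  pose proof (is_RInt_gen_lin _ _ 1 (/ N ^ j) _ _ H1 (is_RInt_gen_gamma_moment (n + j))) as H2.
  match type of H2 with is_RInt_gen _ _ _ ?l => match goal with
    |- is_RInt_gen _ _ _ ?l' => replace l' with l end end.
  - eapply is_RInt_gen_ext_pos; [| exact H2].
    intros t _; cbv beta; unfold Rdiv.
    rewrite Rpow_mult_distr, pow_inv, !pow_add; field; auto.
  - rewrite !pow_add; field; auto.
Qed.

Lemma Cderive_bound_sym (f f' : R -> C) (a b M : R) :
  (forall t, Rmin a b <= t <= Rmax a b -> is_Cderive f t (f' t) /\ Cmod (f' t) <= M) ->
  Cmod (f b - f a) <= 2 * M * Rabs (b - a).
Proof.
  intros H; destruct (Rle_or_lt a b) as [Hab | Hab].
  - rewrite Rabs_right by lra; apply Cderive_bound with f'; [exact Hab |].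
    intros t Ht; apply H; rewrite Rmin_left, Rmax_right; assumption.
  - rewrite Rabs_left, Cmod_minus_sym by lra.
    replace (2 * M * - (b - a)) with (2 * M * (a - b)) by ring.
    apply Cderive_bound with f'; [lra |].
    intros t Ht; apply H; rewrite Rmin_right, Rmax_left; lra.
Qed.

Lemma is_Cderive_power (w : C) (y : R) : 0 < y ->
  is_Cderive (fun y => Cexp (w * ln y)) y (w * Cexp ((w - 1) * ln y)).
Proof.
  intros Hy; eapply is_Cderive_eq.
  - apply (is_Cderive_Cexp (fun y => w * ln y)%C).
    apply is_Cderive_scal, is_Cderive_RtoC, is_derive_Reals, derivable_pt_lim_ln, Hy.
  - replace ((w - 1) * ln y)%C with (w * ln y + RtoC (- ln y))%C by (rewrite RtoC_opp; ring).
    rewrite Cexp_plus, Cexp_RtoC, exp_Ropp, exp_ln by exact Hy; ring.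
Qed.

Lemma Cmod_power (w : C) (y : R) : Cmod (Cexp (w * ln y)) = exp (Re w * ln y).
Proof. rewrite Cmod_Cexp; f_equal; destruct w; simpl; ring. Qed.

(** Replaces a real exponent by an integer one, whose moments are factorials; the 1 covers t <=
    1. *)
Lemma power_le_pow (s t : R) (k : nat) : 0 < s -> s <= INR k -> 0 < t ->
  exp (s * ln t) <= 1 + t ^ k.
Proof.
  intros Hs Hk Ht; destruct (Rle_or_lt t 1) as [H | H].
  - assert (ln t <= 0) by (rewrite <- ln_1; apply ln_le; assumption).
    pose proof (pow_le t k (Rlt_le _ _ Ht)).
    apply Rle_trans with (exp 0); [apply exp_le; nra | rewrite exp_0; lra].
  - assert (0 < ln t) by (rewrite <- ln_1; apply ln_increasing; lra).
    rewrite <- Rpower_pow by exact Ht; unfold Rpower.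
    apply Rle_trans with (exp (INR k * ln t)); [apply exp_le; nra | lra].
Qed.

(** Two applications of the mean value bound, starting from the second derivative z (z - 1) y^(z-2).
    That may blow up at 0, so y < 1/2 is treated apart: there the left side is bounded and (y - 1)^2
    >= 1/4. *)
Lemma power_second_order (z : C) : 0 < Re z ->
  exists (K : R) (k : nat), 0 <= K /\ forall y, 0 < y ->
    Cmod (Cexp (z * ln y) - 1 - z * (y - 1)) <= K * ((y - 1) ^ 2 * (1 + y ^ k)).
Proof.
  intros Hz.
  set (k := Z.to_nat (up (Re z))).
  assert (Hk : Re z <= INR k).
  { destruct (archimed (Re z)) as [H1 _].
    assert (0 <= up (Re z))%Z by (apply le_IZR; lra).
    unfold k; rewrite INR_IZR_INZ, Z2Nat.id by assumption; lra. }
  (* The 4 bounds t^(-2) for t >= 1/2; the remaining t^(Re z) is at most 2 + y^k between 1 and y. *)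
  set (A := 4 * Cmod (z * (z - 1))).
  assert (HA : 0 <= A) by (unfold A; pose proof (Cmod_ge_0 (z * (z - 1))); lra).
  pose proof (Cmod_ge_0 z) as Hz0.
  (* The first term serves y >= 1/2, where the bound is 4 A (2 + y^k) (y - 1)^2; the second serves y
     < 1/2. *)
  exists (12 * A + 4 * (2 + Cmod z))%R, k; split; [lra |]; intros y Hy.
  assert (Hyk : 0 <= y ^ k) by (apply pow_le; lra).
  destruct (Rlt_or_le y (1 / 2)) as [Hsmall | Hbig].
  - assert (B : Cmod (Cexp (z * ln y) - 1 - z * (y - 1)) <= 2 + Cmod z).
    { eapply Rle_trans; [apply Cmod_triangle |].
      rewrite Cmod_opp, Cmod_mult, <- RtoC_minus, Cmod_R.
      assert (Rabs (y - 1) <= 1) by (apply Rabs_le; lra).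
      assert (Cmod (Cexp (z * ln y) - 1) <= 2).
      { eapply Rle_trans; [apply Cmod_triangle |].
        rewrite Cmod_opp, Cmod_1, Cmod_power.
        assert (ln y < 0) by (rewrite <- ln_1; apply ln_increasing; lra).
        assert (exp (Re z * ln y) <= exp 0) by (apply exp_le; nra).
        rewrite exp_0 in *; lra. }
      nra. }
    eapply Rle_trans; [exact B |].
    assert (1 / 4 <= (y - 1) ^ 2) by nra.
    assert (1 / 4 <= (y - 1) ^ 2 * (1 + y ^ k)) by nra.
    nra.
  - assert (H2 : forall t, Rmin 1 y <= t <= Rmax 1 y ->
      1 / 2 <= t /\ Rabs (t - 1) <= Rabs (y - 1) /\
      Cmod (z * ((z - 1) * Cexp ((z - 1 - 1) * ln t))) <= A * (2 + y ^ k)).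
    { intros t Ht.
      assert (Ht' : 1 / 2 <= t /\ Rabs (t - 1) <= Rabs (y - 1) /\ t ^ k <= 1 + y ^ k).
      { destruct (Rle_or_lt 1 y).
        - rewrite Rmin_left, Rmax_right in Ht by lra.
          rewrite !Rabs_right by lra.
          assert (t ^ k <= y ^ k) by (apply pow_incr; lra); lra.
        - rewrite Rmin_right, Rmax_left in Ht by lra.
          rewrite (Rabs_left (y - 1)) by lra.
          assert (t ^ k <= 1 ^ k) by (apply pow_incr; lra); rewrite pow1 in *.
          split; [lra | split; [apply Rabs_le; lra | lra]]. }
      destruct Ht' as (T1 & T2 & T3); split; [exact T1 | split; [exact T2 |]].
      rewrite Cmult_assoc, Cmod_mult, Cmod_power.
      replace (Re (z - 1 - 1) * ln t) with (Re z * ln t + (- ln t + - ln t))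
        by (destruct z; simpl; ring).
      rewrite !exp_plus, !exp_Ropp, !exp_ln by lra.
      pose proof (power_le_pow (Re z) t k Hz Hk ltac:(lra)) as Hp.
      assert (Hi : 0 < / t <= 2).
      { split; [apply Rinv_0_lt_compat; lra |].
        replace 2 with (/ (1 / 2)) by field; apply Rinv_le_contravar; lra. }
      unfold A; rewrite (Rmult_comm 4), Rmult_assoc.
      apply Rmult_le_compat_l; [apply Cmod_ge_0 |].
      pose proof (exp_pos (Re z * ln t)).
      assert (/ t * / t <= 4) by nra.
      rewrite (Rmult_comm 4); apply Rmult_le_compat; nra. }
    (* First integration: the derivative of the remainder, which vanishes at 1. *)
    assert (H1 : forall t, Rmin 1 y <= t <= Rmax 1 y ->
      Cmod (z * Cexp ((z - 1) * ln t) - z) <= 2 * (A * (2 + y ^ k)) * Rabs (y - 1)).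
    { intros t Ht.
      replace (z * Cexp ((z - 1) * ln t) - z)%C
        with (z * Cexp ((z - 1) * ln t) - z * Cexp ((z - 1) * ln 1))%C
        by (rewrite ln_1, Cmult_0_r, Cexp_0; ring).
      eapply Rle_trans.
      - apply (Cderive_bound_sym (fun t => z * Cexp ((z - 1) * ln t))%C
          (fun t => z * ((z - 1) * Cexp ((z - 1 - 1) * ln t)))%C 1 t (A * (2 + y ^ k))).
        intros x Hx.
        assert (Hx' : Rmin 1 y <= x <= Rmax 1 y).
        { revert Hx Ht; unfold Rmin, Rmax.
          destruct (Rle_dec 1 t), (Rle_dec 1 y); lra. }
        split; [| apply H2, Hx'].
        apply is_Cderive_scal, is_Cderive_power; destruct (H2 x Hx'); lra.
      - apply Rmult_le_compat_l; [| apply H2, Ht]; nra. }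
    (* Second integration: the remainder itself, which also vanishes at 1. *)
    pose proof (Cderive_bound_sym (fun t => Cexp (z * ln t) - 1 - z * (t - 1))%C
      (fun t => z * Cexp ((z - 1) * ln t) - z)%C 1 y
      (2 * (A * (2 + y ^ k)) * Rabs (y - 1))) as H0.
    cbv beta in H0.
    rewrite ln_1, Cmult_0_r, Cexp_0 in H0.
    replace (1 - 1 - z * (1 - 1))%C with (RtoC 0) in H0 by ring.
    replace (Cexp (z * ln y) - 1 - z * (y - 1) - 0)%C
      with (Cexp (z * ln y) - 1 - z * (y - 1))%C in H0 by ring.
    eapply Rle_trans; [apply H0 |].
    + intros t Ht; split; [| apply H1, Ht].
      eapply is_Cderive_eq.
      * apply is_Cderive_minus; [apply is_Cderive_minus |].
        -- apply is_Cderive_power; destruct (H2 t Ht); lra.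
        -- apply is_Cderive_const.
        -- apply is_Cderive_scal, is_Cderive_minus; [| apply is_Cderive_const].
           apply is_Cderive_RtoC, (is_derive_id (K := R_AbsRing)).
      * unfold one; simpl; ring.
    + replace ((y - 1) ^ 2) with (Rabs (y - 1) * Rabs (y - 1))
        by (rewrite <- (pow2_abs (y - 1)); ring).
      pose proof (Rabs_pos (y - 1)); set (d := Rabs (y - 1)) in *.
      replace (2 * (2 * (A * (2 + y ^ k)) * d) * d) with (4 * A * (2 + y ^ k) * (d * d)) by ring.
      replace ((12 * A + 4 * (2 + Cmod z)) * (d * d * (1 + y ^ k)))
        with ((12 * A + 4 * (2 + Cmod z)) * (1 + y ^ k) * (d * d)) by ring.
      apply Rmult_le_compat_r; [apply Rmult_le_pos; assumption |].
      assert (0 <= A * y ^ k) by (apply Rmult_le_pos; assumption).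
      assert (0 <= Cmod z * y ^ k) by (apply Rmult_le_pos; assumption).
      nra.
Qed.

(** * Limits of complex sequences *)

Definition is_Clim (u : nat -> C) (l : C) : Prop :=
  is_lim_seq (fun n => Re (u n)) (Re l) /\ is_lim_seq (fun n => Im (u n)) (Im l).

Lemma is_Clim_ext_loc (u v : nat -> C) (l : C) :
  eventually (fun n => u n = v n) -> is_Clim u l -> is_Clim v l.
Proof.
  intros E [H1 H2]; split; eapply is_lim_seq_ext_loc; eauto;
    revert E; apply filter_imp; intros n ->; reflexivity.
Qed.

Lemma is_Clim_ext (u v : nat -> C) (l : C) :
  (forall n, u n = v n) -> is_Clim u l -> is_Clim v l.
Proof. intros E; apply is_Clim_ext_loc; exists O; auto. Qed.

Lemma is_Clim_const (c : C) : is_Clim (fun _ => c) c.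
Proof. split; apply is_lim_seq_const. Qed.

Lemma is_Clim_plus (u v : nat -> C) (l m : C) :
  is_Clim u l -> is_Clim v m -> is_Clim (fun n => u n + v n)%C (l + m)%C.
Proof.
  intros [H1 H2] [H3 H4]; split; simpl; apply is_lim_seq_plus'; assumption.
Qed.

Lemma is_Clim_mult (u v : nat -> C) (l m : C) :
  is_Clim u l -> is_Clim v m -> is_Clim (fun n => u n * v n)%C (l * m)%C.
Proof.
  intros [H1 H2] [H3 H4]; split.
  - apply (is_lim_seq_minus' (fun n => Re (u n) * Re (v n)) (fun n => Im (u n) * Im (v n)));
      apply is_lim_seq_mult'; assumption.
  - apply (is_lim_seq_plus' (fun n => Re (u n) * Im (v n)) (fun n => Im (u n) * Re (v n)));
      apply is_lim_seq_mult'; assumption.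
Qed.

Lemma is_Clim_RtoC (u : nat -> R) (l : R) : is_lim_seq u l -> is_Clim (fun n => RtoC (u n)) l.
Proof. intros H; split; [exact H | apply is_lim_seq_const]. Qed.

Lemma is_Clim_bound (u : nat -> C) (l : C) (e : nat -> R) :
  eventually (fun n => Cmod (u n - l) <= e n) -> is_lim_seq e 0 -> is_Clim u l.
Proof.
  intros H He.
  assert (L : forall (v : nat -> R) (m : R),
    eventually (fun n => Rabs (v n - m) <= e n) -> is_lim_seq v m).
  { intros v m Hv.
    apply is_lim_seq_ext with (fun n => (v n - m) + m); [intros; ring |].
    replace (Finite m) with (Finite (0 + m)) by (f_equal; ring).
    apply is_lim_seq_plus'; [| apply is_lim_seq_const].
    apply is_lim_seq_le_le_loc with (fun n => - e n) e.
    - revert Hv; apply filter_imp; intros n Hn; apply Rabs_le_between, Hn.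
    - replace (Finite 0) with (Finite (- 0)) by (f_equal; ring).
      apply (is_lim_seq_opp e 0), He.
    - exact He. }
  split; apply L; revert H; apply filter_imp; intros n Hn.
  - eapply Rle_trans; [apply (re_le_Cmod (u n - l)) | exact Hn].
  - eapply Rle_trans; [apply (im_le_Cmod (u n - l)) | exact Hn].
Qed.

Lemma is_Clim_unique (u : nat -> C) (l m : C) : is_Clim u l -> is_Clim u m -> l = m.
Proof.
  intros [H1 H2] [H3 H4]; apply C_ext.
  - apply is_lim_seq_unique in H1; apply is_lim_seq_unique in H3; congruence.
  - apply is_lim_seq_unique in H2; apply is_lim_seq_unique in H4; congruence.
Qed.

Lemma is_Clim_Cexp (u : nat -> C) (l : C) :
  is_Clim u l -> is_Clim (fun n => Cexp (u n)) (Cexp l).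
Proof.
  intros [H1 H2]; split; simpl; apply is_lim_seq_mult'.
  - apply (is_lim_seq_continuous exp _ (Re l)); [apply derivable_continuous_pt, derivable_pt_exp | exact H1].
  - apply (is_lim_seq_continuous cos _ (Im l)); [apply continuity_cos | exact H2].
  - apply (is_lim_seq_continuous exp _ (Re l)); [apply derivable_continuous_pt, derivable_pt_exp | exact H1].
  - apply (is_lim_seq_continuous sin _ (Im l)); [apply continuity_sin | exact H2].
Qed.

(** * Rising factorials and Gauss's formula *)

Lemma Cprod_seq_S (f : nat -> C) (a n : nat) :
  Cprod f (seq a (S n)) = (Cprod f (seq a n) * f (a + n)%nat)%C.
Proof.
  revert a; induction n as [| n IH]; intros a.
  - unfold Cprod; simpl; rewrite Nat.add_0_r; ring.
  - change (Cprod f (seq a (S (S n)))) with (f a * Cprod f (seq (S a) (S n)))%C.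
    change (Cprod f (seq a (S n))) with (f a * Cprod f (seq (S a) n))%C.
    rewrite IH, Nat.add_succ_comm; ring.
Qed.

Definition rising (z : C) (n : nat) : C := Cprod (fun k : nat => z + INR k)%C (seq 0 n).

Lemma rising_S (z : C) (n : nat) : rising z (S n) = (rising z n * (z + INR n))%C.
Proof. apply Cprod_seq_S. Qed.

Lemma rising_S_l (z : C) (n : nat) : rising z (S n) = (z * rising (z + 1) n)%C.
Proof.
  induction n as [| n IH].
  - unfold rising, Cprod; simpl; ring.
  - rewrite rising_S, IH, rising_S, S_INR, RtoC_plus; ring.
Qed.

Lemma Gamma_integral_rising (z : C) (n : nat) : 0 < Re z ->
  Gamma_integral (z + INR n) = (rising z n * Gamma_integral z)%C.
Proof.
  intros Hz; induction n as [| n IH].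
  - unfold rising, Cprod; simpl; replace (z + 0)%C with z by ring; ring.
  - rewrite S_INR, RtoC_plus, Cplus_assoc, Gamma_integral_succ, IH, rising_S.
    + ring.
    + pose proof (pos_INR n); destruct z; simpl in *; lra.
Qed.

(* Gauss's product, with its index shifted by one so as to start at 1. *)
Definition gauss (z : C) (n : nat) : C :=
  (rising z (S n) * Cexp (- z * ln (INR (S n))) / INR (fact n))%C.

(** The expectation of (T/(n+1))^j for T with the Gamma(n+1) distribution. *)
Definition moment (n j : nat) : R := INR (fact (n + j)) / INR (fact n) / INR (S n) ^ j.

Lemma moment_limit (j : nat) : is_lim_seq (fun n => moment n j) 1.
Proof.
  induction j as [| j IH].
  - apply is_lim_seq_ext with (fun _ => 1); [| apply is_lim_seq_const].
    intros n; unfold moment; rewrite Nat.add_0_r; simpl; field; apply INR_fact_neq_0.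
  (* Consecutive moments have ratio (n + 1 + j) / (n + 1). *)
  - apply is_lim_seq_ext with (fun n => moment n j * (1 + INR j * / INR (S n))).
    + intros n; unfold moment.
      replace (n + S j)%nat with (S (n + j)) by lia.
      rewrite fact_simpl, mult_INR, !S_INR, plus_INR.
      rewrite <- tech_pow_Rmult.
      pose proof (pos_INR n); field; repeat split; try apply pow_nonzero; try lra.
      apply INR_fact_neq_0.
    + replace (Finite 1) with (Finite (1 * (1 + INR j * 0))) by (f_equal; ring).
      apply is_lim_seq_mult'; [exact IH |].
      apply is_lim_seq_plus'; [apply is_lim_seq_const |].
      apply is_lim_seq_mult'; [apply is_lim_seq_const |].
      apply (is_lim_seq_incr_1 (fun n => / INR n)).
      apply (is_lim_seq_inv _ p_infty); [apply is_lim_seq_INR | discriminate].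
Qed.

(* If T has the Gamma(n+1) distribution, then the left hand side is the distance
   from 1 of the expectation of (T/(n+1))^z, and [power_second_order] bounds it by
   moments of T of integer order. *)
Lemma gauss_bound (z : C) : 0 < Re z -> exists (K : R) (k : nat), forall n,
  Cmod (gauss z n * Gamma_integral z - 1) <=
    K * ((moment n 2 - 2 * moment n 1 + moment n 0)
         + (moment n (k + 2) - 2 * moment n (k + 1) + moment n k)).
Proof.
  intros Hz; destruct (power_second_order z Hz) as (K & k & HK & Hb).
  exists (2 * K), k; intros n.
  set (N := INR (S n)).
  assert (HN : 0 < N) by (apply lt_0_INR; lia).
  assert (HNC : RtoC N <> 0%C) by (intros E; apply RtoC_inj in E; lra).
  assert (HN1 : 0 < Re (RtoC N)) by exact HN.
  assert (HzN : 0 < Re (z + N)) by (destruct z; simpl in *; lra).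
  assert (HN2 : 0 < Re (N + 1)) by (simpl; lra).
  (* With y = t/N, y^z - 1 - z (y - 1) = N^(-z) t^z + (z - 1) - (z/N) t. A factor t^z or t raises
     the argument N of the kernel by z or by 1. *)
  pose proof (is_Cint_scal (Cexp (- z * ln N)) _ _ (is_Cint_gamma_kernel _ HzN)) as I1.
  pose proof (is_Cint_scal (z - 1) _ _ (is_Cint_gamma_kernel _ HN1)) as I2.
  pose proof (is_Cint_scal (- z / N) _ _ (is_Cint_gamma_kernel _ HN2)) as I3.
  pose proof (is_Cint_plus _ _ _ _ (is_Cint_plus _ _ _ _ I1 I2) I3) as I; clear I1 I2 I3.
  assert (G0 : Gamma_integral N = INR (fact n)).
  { unfold N; rewrite S_INR, RtoC_plus; apply Gamma_integral_nat. }
  pose proof (INR_fact_lt_0 n) as Hf.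
  assert (HfC : RtoC (INR (fact n)) <> 0%C) by (intros E; apply RtoC_inj in E; lra).
  assert (G1 : Gamma_integral (z + N) = (rising z (S n) * Gamma_integral z)%C)
    by apply Gamma_integral_rising, Hz.
  rewrite Gamma_integral_succ, G0, G1 in I by exact HN1.
  (* Since Gamma(N + 1) = N Gamma(N), the last two integrals add up to - n!: the first order term
     has mean 0. *)
  match type of I with is_Cint _ ?l => replace l with
     (INR (fact n) * (gauss z n * Gamma_integral z - 1))%C in I end.
  2:{ unfold gauss; fold N; field; auto. }
  pose proof (is_RInt_gen_lin _ _ K K _ _ (is_RInt_gen_gamma_shifted_square n 0)
    (is_RInt_gen_gamma_shifted_square n k)) as J; cbv zeta in J; fold N in J.
  pose proof (fun H => is_Cint_bound _ _ _ _ H I J) as B; cbv beta in B.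
  rewrite Cmod_mult, Cmod_R, Rabs_right in B by lra.
  apply Rmult_le_reg_l with (INR (fact n)); [exact Hf |].
  eapply Rle_trans; [apply B |].
  - intros t Ht.
    match goal with |- Cmod ?w <= _ => replace w with
      (gamma_kernel N t * (Cexp (z * ln (t / N)) - 1 - z * (RtoC (t / N) - 1)))%C end.
    + rewrite Cmod_mult, Rmult_comm.
      assert (E : Cmod (gamma_kernel N t) = t ^ n * exp (- t)).
      { rewrite Cmod_gamma_kernel; unfold N; rewrite re_RtoC, S_INR.
        replace ((INR n + 1 - 1) * ln t - t) with (INR n * ln t + - t) by ring.
        rewrite exp_plus, <- Rpower_pow by exact Ht; reflexivity. }
      rewrite E; assert (0 < t / N) by (apply Rdiv_lt_0_compat; assumption).
      assert (0 <= t ^ n * exp (- t)).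
      { apply Rmult_le_pos; [apply pow_le; lra | left; apply exp_pos]. }
      eapply Rle_trans; [apply Rmult_le_compat_r; [assumption | apply Hb; assumption] |].
      apply Req_le; simpl; ring.
    + rewrite (gamma_kernel_succ N t Ht).
      replace (gamma_kernel (z + N) t) with (Cexp (z * ln t) * gamma_kernel N t)%C
        by (unfold gamma_kernel; rewrite <- Cexp_plus; f_equal; ring).
      replace (Cexp (z * ln (t / N))) with (Cexp (- z * ln N) * Cexp (z * ln t))%C
        by (rewrite <- Cexp_plus, ln_div, RtoC_minus by assumption; f_equal; ring).
      rewrite RtoC_div by lra; field; exact HNC.
  - apply Req_le; unfold moment; fold N.
    rewrite !Nat.add_0_r, !Nat.add_assoc; simpl pow; field.
    repeat split; try apply pow_nonzero; try lra.
    all: rewrite ?pow_add; apply Rmult_integral_contrapositive; split; apply pow_nonzero; lra.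
Qed.

(** In [gauss_bound] the moments combine to 1 - 2 + 1 = 0 in the limit. The limit 1 of the product
    with Gamma(z) also shows that Gamma(z) is not 0. *)
Lemma gauss_limit_pos (z : C) : 0 < Re z ->
  Gamma_integral z <> 0%C /\ is_Clim (gauss z) (/ Gamma_integral z)%C.
Proof.
  intros Hz; destruct (gauss_bound z Hz) as (K & k & Hb).
  assert (H : is_Clim (fun n => gauss z n * Gamma_integral z)%C 1).
  { eapply is_Clim_bound; [exists O; intros n _; apply Hb |].
    replace (Finite 0) with (Finite (K * ((1 - 2 * 1 + 1) + (1 - 2 * 1 + 1)))) by (f_equal; ring).
    apply is_lim_seq_mult'; [apply is_lim_seq_const |].
    apply is_lim_seq_plus'; apply is_lim_seq_plus'; try apply moment_limit;
      apply is_lim_seq_minus'; try apply moment_limit;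
      apply is_lim_seq_mult'; try apply moment_limit; apply is_lim_seq_const. }
  assert (H0 : Gamma_integral z <> 0%C).
  { intros E; apply C1_nz; apply (is_Clim_unique (fun _ => 0)%C).
    - eapply is_Clim_ext; [| exact H]; intros n; simpl; rewrite E; ring.
    - apply is_Clim_const. }
  split; [exact H0 |].
  eapply is_Clim_ext; [| replace (/ Gamma_integral z)%C with (1 * / Gamma_integral z)%C by ring;
    apply is_Clim_mult; [exact H | apply is_Clim_const]].
  intros n; simpl; field; exact H0.
Qed.

(** [gauss z n] is z (n+1) / (z+n+1) times [gauss (z + 1) n]. This carries Gauss's formula to the
    left half-plane, and at a pole of Gamma some factor z = 0 makes the limit 0. *)
Lemma gauss_limit_shift (z l : C) : is_Clim (gauss (z + 1)) l -> is_Clim (gauss z) (z * l)%C.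
Proof.
  intros H.
  assert (Hn : eventually (fun n => 2 * Cmod z + 1 <= INR (S n))).
  { destruct (nfloor_ex (2 * Cmod z + 1)) as [m Hm].
    { pose proof (Cmod_ge_0 z); lra. }
    exists m; intros n Hn; apply le_INR in Hn; rewrite S_INR; lra. }
  assert (Hr : eventually (fun n => INR (S n) / 2 <= Cmod (z + INR (S n)))).
  { revert Hn; apply filter_imp; intros n Hn.
    pose proof (Cmod_triangle (z + INR (S n)) (- z)) as T.
    replace (z + INR (S n) + - z)%C with (RtoC (INR (S n))) in T by ring.
    rewrite Cmod_opp, Cmod_R, Rabs_right in T by (apply Rle_ge, pos_INR).
    lra. }
  assert (L : is_Clim (fun n => INR (S n) / (z + INR (S n)))%C 1).
  { apply is_Clim_bound with (fun n => 2 * Cmod z * / INR (S n)).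
    - generalize Hr; apply filter_imp; clear Hr Hn; intros n Hn.
      assert (0 < INR (S n)) by (apply lt_0_INR; lia).
      assert (z + INR (S n) <> 0)%C by (apply Cmod_gt_0; lra).
      replace (INR (S n) / (z + INR (S n)) - 1)%C with (- z / (z + INR (S n)))%C
        by (field; assumption).
      rewrite Cmod_div, Cmod_opp by assumption.
      replace (2 * Cmod z * / INR (S n)) with (Cmod z / (INR (S n) / 2)) by (field; lra).
      apply Rmult_le_compat_l; [apply Cmod_ge_0 | apply Rinv_le_contravar; lra].
    - replace (Finite 0) with (Finite (2 * Cmod z * 0)) by (f_equal; ring).
      apply is_lim_seq_mult'; [apply is_lim_seq_const |].
      apply (is_lim_seq_incr_1 (fun n => / INR n)).
      apply (is_lim_seq_inv _ p_infty); [apply is_lim_seq_INR | discriminate]. }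
  replace (z * l)%C with (z * (l * 1))%C by ring.
  apply is_Clim_ext_loc with (fun n => z * (gauss (z + 1) n * (INR (S n) / (z + INR (S n)))))%C.
  2:{ apply is_Clim_mult; [apply is_Clim_const | apply is_Clim_mult; assumption]. }
  generalize Hr; apply filter_imp; clear Hr Hn; intros n Hn.
  assert (HN : 0 < INR (S n)) by (apply lt_0_INR; lia).
  assert (Hz : (z + INR (S n) <> 0)%C) by (apply Cmod_gt_0; lra).
  assert (HNC : RtoC (INR (S n)) <> 0%C) by (intros E; apply RtoC_inj in E; lra).
  assert (Hf : RtoC (INR (fact n)) <> 0%C)
    by (intros E; apply RtoC_inj in E; revert E; apply INR_fact_neq_0).
  unfold gauss.
  replace (- (z + 1) * ln (INR (S n)))%C with (- z * ln (INR (S n)) + RtoC (- ln (INR (S n))))%C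
    by (rewrite RtoC_opp; ring).
  rewrite Cexp_plus, Cexp_RtoC, exp_Ropp, exp_ln, RtoC_inv by lra.
  assert (E : (rising z (S n) = z * rising (z + 1) (S n) / (z + INR (S n)))%C).
  { rewrite <- rising_S_l, (rising_S z (S n)); field; exact Hz. }
  rewrite E; field; auto.
Qed.

Lemma gauss_limit (z : C) : is_Clim (gauss z) (inv_Gamma z).
Proof.
  unfold inv_Gamma; fold (rising z (Gamma_shift z)).
  assert (Hm : 0 < Re (z + INR (Gamma_shift z))).
  { unfold Gamma_shift.
    replace (Re (z + INR (Z.to_nat (up (- Re z))))) with (Re z + INR (Z.to_nat (up (- Re z))))
      by (destruct z; reflexivity).
    destruct (archimed (- Re z)) as [H1 H2].
    destruct (Z_le_gt_dec 0 (up (- Re z))) as [H | H].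
    - rewrite INR_IZR_INZ, Z2Nat.id by assumption; lra.
    (* [Z.to_nat] truncates to 0 here, and Re z is already positive. *)
    - assert (up (- Re z) <= -1)%Z by lia.
      apply IZR_le in H0; replace (Z.to_nat (up (- Re z))) with O by lia; simpl; lra. }
  (* Any shift m with 0 < Re z + m is allowed, so that the induction can lower m while it raises z
     by 1. *)
  revert Hm; generalize (Gamma_shift z); intros m; revert z.
  induction m as [| m IH]; intros z Hm.
  - unfold rising, Cprod; simpl; simpl INR in Hm.
    replace (z + 0)%C with z in * by ring.
    replace (1 / Gamma_integral z)%C with (/ Gamma_integral z)%C by (unfold Cdiv; ring).
    apply gauss_limit_pos, Hm.
  - rewrite rising_S_l, S_INR, RtoC_plus in *.
    replace (z + (INR m + 1))%C with (z + 1 + INR m)%C in * by ring.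
    unfold Cdiv; rewrite <- Cmult_assoc; apply gauss_limit_shift, IH, Hm.
Qed.

(** * Wallis's product and Euler's constant *)

Definition wallis (n : nat) : R := RInt (fun x => sin x ^ n) 0 (PI / 2).

Lemma ex_derive_sin_pow (n : nat) (x : R) : ex_derive (fun x => sin x ^ n) x.
Proof. auto_derive; auto. Qed.

Lemma ex_RInt_sin_pow (n : nat) : ex_RInt (fun x => sin x ^ n) 0 (PI / 2).
Proof.
  apply (ex_RInt_continuous (V := R_CompleteNormedModule)); intros x _.
  apply (ex_derive_continuous (V := R_NormedModule)), ex_derive_sin_pow.
Qed.

Lemma wallis_0 : wallis 0 = PI / 2.
Proof.
  unfold wallis; simpl; rewrite RInt_const; unfold scal; simpl; unfold mult; simpl; ring.
Qed.

Lemma wallis_1 : wallis 1 = 1.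
Proof.
  unfold wallis; apply is_RInt_unique.
  replace 1 with (minus (- cos (PI / 2)) (- cos 0))
    by (unfold minus, plus, opp; simpl; rewrite cos_PI2, cos_0; ring).
  apply (is_RInt_derive (V := R_CompleteNormedModule) (fun x => - cos x)).
  - intros x _; auto_derive; [auto | simpl; ring].
  - intros x _; apply (ex_derive_continuous (V := R_NormedModule)), ex_derive_sin_pow.
Qed.

(** [f] is the derivative of - cos x sin^(n+1) x, which vanishes at both ends. *)
Lemma wallis_rec (n : nat) : INR (n + 2) * wallis (n + 2) = INR (n + 1) * wallis n.
Proof.
  set (f := fun x => INR (n + 2) * sin x ^ (n + 2) - INR (n + 1) * sin x ^ n).
  assert (H : is_RInt f 0 (PI / 2) 0).
  { replace 0 with (minus (- cos (PI / 2) * sin (PI / 2) ^ (n + 1)) (- cos 0 * sin 0 ^ (n + 1))) at 2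
      by (unfold minus, plus, opp; simpl; rewrite cos_PI2, sin_0, Nat.add_1_r; simpl; ring).
    apply (is_RInt_derive (V := R_CompleteNormedModule) (fun x => - cos x * sin x ^ (n + 1))).
    - intros x _; auto_derive; [auto |].
      replace (Nat.pred (n + 1)) with n by lia.
      unfold f; rewrite !pow_add; replace (n + 2)%nat with (S (n + 1)) by lia; rewrite S_INR.
      pose proof (sin2_cos2 x) as E; unfold Rsqr in E.
      replace (- cos x * (1 * cos x * (INR (n + 1) * sin x ^ n)))
        with (- INR (n + 1) * sin x ^ n * (cos x * cos x)) by ring.
      replace (cos x * cos x) with (1 - sin x * sin x) by lra; ring.
    - intros x _; apply (ex_derive_continuous (V := R_NormedModule)).
      unfold f; auto_derive; auto. }
  assert (H' : is_RInt f 0 (PI / 2) (INR (n + 2) * wallis (n + 2) - INR (n + 1) * wallis n)).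
  { apply (is_RInt_minus (V := R_NormedModule) (fun x => INR (n + 2) * sin x ^ (n + 2))
      (fun x => INR (n + 1) * sin x ^ n));
      apply (is_RInt_scal (V := R_NormedModule)), (RInt_correct (V := R_CompleteNormedModule)),
        ex_RInt_sin_pow. }
  apply (is_RInt_unique (V := R_CompleteNormedModule)) in H, H'; lra.
Qed.

Lemma wallis_decr (n : nat) : wallis (S n) <= wallis n.
Proof.
  pose proof PI_RGT_0; apply RInt_le; try apply ex_RInt_sin_pow; [lra |].
  intros x Hx; simpl.
  assert (0 <= sin x) by (apply sin_ge_0; lra).
  pose proof (SIN_bound x); pose proof (pow_le _ n H0); nra.
Qed.

Lemma wallis_prod (n : nat) : INR (n + 1) * (wallis n * wallis (S n)) = PI / 2.
Proof.
  induction n as [| n IH].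
  - rewrite wallis_0, wallis_1; simpl; ring.
  - rewrite <- IH; pose proof (wallis_rec n) as H.
    replace (S (S n)) with (n + 2)%nat by lia.
    replace (S n + 1)%nat with (n + 2)%nat by lia.
    replace (INR (n + 2) * (wallis (S n) * wallis (n + 2)))
      with (INR (n + 2) * wallis (n + 2) * wallis (S n)) by ring.
    rewrite H; ring.
Qed.

Fixpoint half_rising (n : nat) : R :=
  match n with O => 1 | S m => half_rising m * (1 / 2 + INR m) end.

Lemma half_rising_pos (n : nat) : 0 < half_rising n.
Proof.
  induction n as [| n IH]; simpl; [lra |].
  pose proof (pos_INR n); apply Rmult_lt_0_compat; lra.
Qed.

Lemma rising_half (n : nat) : rising (1 / 2) n = half_rising n.
Proof.
  induction n as [| n IH]; [reflexivity |].
  rewrite rising_S, IH; simpl half_rising.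
  rewrite RtoC_mult, RtoC_plus, RtoC_div by lra; reflexivity.
Qed.

Lemma wallis_even (n : nat) : wallis (2 * n) = PI / 2 * (half_rising n / INR (fact n)).
Proof.
  induction n as [| n IH].
  - simpl; rewrite wallis_0; field.
  - pose proof (wallis_rec (2 * n)) as H.
    replace (2 * S n)%nat with (2 * n + 2)%nat by lia.
    assert (Hn : INR (2 * n + 2) = 2 * INR n + 2) by (rewrite plus_INR, mult_INR; simpl; ring).
    assert (Hn' : INR (2 * n + 1) = 2 * INR n + 1) by (rewrite plus_INR, mult_INR; simpl; ring).
    rewrite Hn, Hn', IH in H.
    pose proof (pos_INR n); pose proof (INR_fact_neq_0 n).
    apply Rmult_eq_reg_l with (2 * INR n + 2); [| lra].
    rewrite H, fact_simpl, mult_INR, S_INR; simpl; field; split; [assumption | lra].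
Qed.

(** In effect Gamma(1/2)^2 = PI. With N = n + 1 and W = [wallis (2 * N)], [gauss (1 / 2) n] equals
    (2/PI) sqrt(N) W. Monotonicity puts W^2 between the products of W with its two neighbours, known
    from [wallis_prod], so N W^2 tends to PI/4. *)
Lemma gauss_half_limit : is_Clim (fun n => / gauss (1 / 2) n ^ 2)%C PI.
Proof.
  apply is_Clim_ext with (fun n => RtoC ((PI / 2) ^ 2 / (INR (S n) * wallis (2 * S n) ^ 2))).
  - intros n; pose proof (INR_fact_lt_0 n) as Hf.
    assert (HN : 0 < INR (S n)) by (apply lt_0_INR; lia).
    pose proof (half_rising_pos (S n)) as Hh; pose proof PI_RGT_0 as Hpi.
    assert (E : gauss (1 / 2) n = RtoC (half_rising (S n) * / sqrt (INR (S n)) / INR (fact n))).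
    { unfold gauss; rewrite rising_half.
      replace (- (1 / 2) * ln (INR (S n)))%C with (RtoC (- ln (sqrt (INR (S n))))).
      - pose proof (sqrt_lt_R0 _ HN).
        rewrite Cexp_RtoC, exp_Ropp, exp_ln, RtoC_div, RtoC_mult by lra; reflexivity.
      - pose proof (sqrt_lt_R0 _ HN).
        rewrite <- (sqrt_sqrt (INR (S n))) at 2 by lra.
        rewrite ln_mult by assumption; rewrite RtoC_plus, RtoC_opp; field. }
    rewrite E, <- RtoC_pow.
    pose proof (sqrt_lt_R0 _ HN) as Hs.
    rewrite <- RtoC_inv; [f_equal |].
    + rewrite wallis_even, fact_simpl, mult_INR.
      replace ((half_rising (S n) * / sqrt (INR (S n)) / INR (fact n)) ^ 2)
        with (half_rising (S n) ^ 2 / (sqrt (INR (S n)) * sqrt (INR (S n))) / INR (fact n) ^ 2)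
        by (field; lra).
      rewrite sqrt_sqrt by lra; field; repeat split; lra.
    + apply pow_nonzero, Rmult_integral_contrapositive; split;
        [apply Rmult_integral_contrapositive; split |];
        try apply Rinv_neq_0_compat; lra.
  - apply is_Clim_RtoC.
    apply is_lim_seq_le_le with (fun _ => PI) (fun n => PI * (1 + / 2 * / INR (S n))).
    + intros n.
      assert (HN : 0 < INR (S n)) by (apply lt_0_INR; lia).
      pose proof PI_RGT_0 as Hpi.
      assert (Hw : 0 < wallis (2 * S n)).
      { rewrite wallis_even; apply Rmult_lt_0_compat; [lra |].
        apply Rdiv_lt_0_compat; [apply half_rising_pos | apply INR_fact_lt_0]. }
      pose proof (wallis_prod (2 * S n)) as P1.
      pose proof (wallis_decr (2 * S n)) as D1.
      assert (P2 : INR (2 * S n) * (wallis (2 * S n - 1) * wallis (2 * S n)) = PI / 2).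
      { rewrite <- (wallis_prod (2 * S n - 1)).
        replace (S (2 * S n - 1)) with (2 * S n)%nat by lia.
        replace (2 * S n - 1 + 1)%nat with (2 * S n)%nat by lia; reflexivity. }
      pose proof (wallis_decr (2 * S n - 1)) as D2.
      replace (S (2 * S n - 1)) with (2 * S n)%nat in D2 by lia.
      rewrite plus_INR, mult_INR in P1; rewrite mult_INR in P2; simpl (INR 2) in *; simpl (INR 1) in *.
      set (N := INR (S n)) in *; set (w := wallis (2 * S n)) in *.
      assert (B1 : 2 * N * w ^ 2 <= PI / 2).
      { rewrite <- P2; replace (w ^ 2) with (w * w) by ring.
        apply Rmult_le_compat_l; [lra | apply Rmult_le_compat_r; lra]. }
      assert (B2 : PI / 2 <= (2 * N + 1) * w ^ 2).
      { rewrite <- P1; replace (w ^ 2) with (w * w) by ring.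
        apply Rmult_le_compat_l; [lra | apply Rmult_le_compat_l; lra]. }
      assert (Hw2 : 0 < w ^ 2) by (apply pow_lt, Hw).
      assert (HNw : 0 < N * w ^ 2) by (apply Rmult_lt_0_compat; assumption).
      split; apply Rmult_le_reg_r with (N * w ^ 2); try exact HNw.
      * replace ((PI / 2) ^ 2 / (N * w ^ 2) * (N * w ^ 2)) with ((PI / 2) ^ 2) by (field; split; lra).
        nra.
      * replace ((PI / 2) ^ 2 / (N * w ^ 2) * (N * w ^ 2)) with ((PI / 2) ^ 2) by (field; split; lra).
        replace (PI * (1 + / 2 * / N) * (N * w ^ 2)) with (PI / 2 * ((2 * N + 1) * w ^ 2)) by (field; lra).
        replace ((PI / 2) ^ 2) with (PI / 2 * (PI / 2)) by ring; apply Rmult_le_compat_l; lra.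
    + apply is_lim_seq_const.
    + replace (Finite PI) with (Finite (PI * (1 + / 2 * 0))) by (f_equal; ring).
      apply is_lim_seq_mult'; [apply is_lim_seq_const |].
      apply is_lim_seq_plus'; [apply is_lim_seq_const |].
      apply is_lim_seq_mult'; [apply is_lim_seq_const |].
      apply (is_lim_seq_incr_1 (fun n => / INR n)).
      apply (is_lim_seq_inv _ p_infty); [apply is_lim_seq_INR | discriminate].
Qed.

(** * Harmonic sums and Euler's constant *)

Definition harmonic (n : nat) : R := sum_n (fun i : nat => / INR (S i)) n.

Lemma harmonic_S (n : nat) : harmonic (S n) = harmonic n + / INR (S (S n)).
Proof. unfold harmonic; rewrite sum_Sn; reflexivity. Qed.

(** [Euler_gamma] is the real part of a [Lim_seq], so finite convergence has to be proved: the
    sequence decreases and is nonnegative, both by ln y <= y - 1. *)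
Lemma Euler_gamma_limit :
  is_lim_seq (fun k => harmonic k - ln (INR (S k))) Euler_gamma.
Proof.
  assert (P : forall k, 0 < INR (S k)) by (intros; apply lt_0_INR; lia).
  assert (H : ex_finite_lim_seq (fun k => harmonic k - ln (INR (S k)))).
  { apply ex_finite_lim_seq_decr with 0.
    - intros k; rewrite harmonic_S.
      pose proof (ln_le_sub_1 (INR (S k) / INR (S (S k))) ltac:(apply Rdiv_lt_0_compat; apply P)) as L.
      rewrite ln_div in L by apply P.
      replace (INR (S k) / INR (S (S k)) - 1) with (- / INR (S (S k))) in L.
      + lra.
      + rewrite (S_INR (S k)); pose proof (P k); field; lra.
    (* The logarithm is taken one index further so that the induction closes: the new term 1/(k+2)
       dominates ln (k+3) - ln (k+2), but not ln (k+2) - ln (k+1). *)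
    - assert (forall k, ln (INR (S (S k))) <= harmonic k).
      { induction k as [| k IH].
        - unfold harmonic; rewrite sum_O; simpl.
          pose proof (ln_le_sub_1 (1 + 1)); lra.
        - rewrite harmonic_S.
          pose proof (ln_le_sub_1 (INR (S (S (S k))) / INR (S (S k)))
            ltac:(apply Rdiv_lt_0_compat; apply P)) as L.
          rewrite ln_div in L by apply P.
          replace (INR (S (S (S k))) / INR (S (S k)) - 1) with (/ INR (S (S k))) in L.
          + lra.
          + rewrite (S_INR (S (S k))); pose proof (P (S k)); field; lra. }
      intros k; specialize (H k).
      assert (ln (INR (S k)) <= ln (INR (S (S k)))).
      { apply ln_le; [apply P | apply le_INR; lia]. }
      lra. }
  apply Lim_seq_correct'; exact H.
Qed.

Definition odd_harmonic (n : nat) : R := sum_n (fun i : nat => / (2 * INR i + 1)) n.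

Lemma odd_harmonic_S (n : nat) : odd_harmonic (S n) = odd_harmonic n + / (2 * INR (S n) + 1).
Proof. unfold odd_harmonic; rewrite sum_Sn; reflexivity. Qed.

(** The reciprocals of 1, ..., 2n+2 minus those of the even numbers; [harmonic n] ends with
    1/(n+1). *)
Lemma odd_harmonic_eq (n : nat) : odd_harmonic n = harmonic (2 * n + 1) - harmonic n / 2.
Proof.
  induction n as [| n IH].
  - unfold odd_harmonic, harmonic; simpl; rewrite sum_Sn, !sum_O; unfold plus; simpl; field.
  - rewrite odd_harmonic_S, IH.
    replace (2 * S n + 1)%nat with (S (S (2 * n + 1))) by lia.
    rewrite !harmonic_S, !S_INR, !plus_INR, !mult_INR; simpl (INR 2); simpl (INR 1).
    pose proof (pos_INR n); field; repeat split; lra.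
Qed.

(** ln (2 (n+1)) - ln (n+1) / 2 = ln (n+1) / 2 + ln 2; this ln 2 is the origin of 2^(-p) in the
    constant. *)
Lemma odd_harmonic_limit :
  is_lim_seq (fun n => odd_harmonic n - ln (INR (S n)) / 2) (Euler_gamma / 2 + ln 2).
Proof.
  apply is_lim_seq_ext with (fun n =>
    (harmonic (2 * n + 1) - ln (INR (S (2 * n + 1)))) - / 2 * (harmonic n - ln (INR (S n))) + ln 2).
  - intros n; rewrite odd_harmonic_eq.
    replace (S (2 * n + 1)) with (2 * S n)%nat by lia.
    rewrite mult_INR; replace (INR 2) with 2 by (simpl; ring).
    rewrite ln_mult; [field | lra | apply lt_0_INR; lia].
  - replace (Finite (Euler_gamma / 2 + ln 2))
      with (Finite (Euler_gamma - / 2 * Euler_gamma + ln 2)) by (f_equal; field).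
    apply is_lim_seq_plus'; [| apply is_lim_seq_const].
    apply is_lim_seq_minus'.
    + apply (is_lim_seq_subseq (fun k => harmonic k - ln (INR (S k))) _ (fun n => (2 * n + 1)%nat));
        [apply eventually_subseq; intros; lia | apply Euler_gamma_limit].
    + apply is_lim_seq_mult'; [apply is_lim_seq_const | apply Euler_gamma_limit].
Qed.

(** * The limit of the product *)

Definition Rfactor (p q : C) (d : R) : C := (Cexp (- p / d) * (1 + p / d + q / d ^ 2))%C.

Lemma Rprod_S (p q : C) (n : nat) :
  Rprod p q (S n) = (Rprod p q n * Rfactor p q (2 * INR n + 1))%C.
Proof.
  unfold Rprod; rewrite Cprod_seq_S; f_equal.
  cbv zeta; unfold Rfactor.
  replace (2 * INR (1 + n) - 1) with (2 * INR n + 1) by (rewrite plus_INR; simpl; ring).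
  reflexivity.
Qed.

(** With u + v = p/2 and u v = q/4, the factor for d = 2m + 1 splits as (1/2 + m + u) (1/2 + m + v)
    / (1/2 + m)^2. *)
Lemma Rprod_eq (p q Delta : C) (HDelta : (Delta ^ 2 = p ^ 2 - 4 * q)%C) (n : nat) :
  Rprod p q (S n) =
    (Cexp (- p * odd_harmonic n) * rising (1 / 2 + p / 4 + Delta / 4) (S n)
     * rising (1 / 2 + p / 4 - Delta / 4) (S n) / rising (1 / 2) (S n) ^ 2)%C.
Proof.
  assert (Hr : forall m, rising (1 / 2) m <> 0%C).
  { intros m E; rewrite rising_half in E; apply RtoC_inj in E; pose proof (half_rising_pos m); lra. }
  assert (Hq : q = ((p ^ 2 - Delta ^ 2) / 4)%C) by (rewrite HDelta; field).
  assert (F : forall m, ((1 + p / RtoC (2 * INR m + 1)%R + q / RtoC (2 * INR m + 1)%R ^ 2)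
     = (1 / 2 + p / 4 + Delta / 4 + INR m) * (1 / 2 + p / 4 - Delta / 4 + INR m)
       / (1 / 2 + INR m) ^ 2)%C).
  { intros m; pose proof (pos_INR m).
    assert (Hd : (2 * INR m + 1 <> 0)%C).
    { rewrite <- RtoC_mult, <- RtoC_plus; intros E; apply RtoC_inj in E; lra. }
    rewrite Hq, RtoC_plus, RtoC_mult; field; repeat split; auto.
    cbv beta; intros E; apply Hd; rewrite <- E; ring. }
  induction n as [| n IH].
  - rewrite Rprod_S; unfold Rfactor; rewrite F.
    unfold Rprod, rising, odd_harmonic, Cprod; simpl; rewrite sum_O; simpl.
    replace (- p / RtoC (2 * 0 + 1)%R)%C with (- p * RtoC (/ (2 * 0 + 1))%R)%C
      by (rewrite RtoC_inv by lra; reflexivity).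
    field.
  - rewrite Rprod_S, IH; unfold Rfactor; rewrite F.
    rewrite odd_harmonic_S, (RtoC_plus (odd_harmonic n)), !(rising_S _ (S n)).
    replace (- p * (odd_harmonic n + RtoC (/ (2 * INR (S n) + 1))%R))%C
      with (- p * odd_harmonic n + - p / RtoC (2 * INR (S n) + 1)%R)%C.
    + rewrite Cexp_plus; field; split; [| apply Hr].
      cbv beta; intros E; apply (Hr (S (S n))); rewrite (rising_S _ (S n)).
      match type of E with ?x = _ =>
        replace (1 / 2 + INR (S n))%C with (x / 2)%C by field; rewrite E end; field.
    + pose proof (pos_INR (S n)); rewrite RtoC_inv by lra; unfold Cdiv; ring.
Qed.

(** As a + b = 1 + p/2, the three Gauss products together carry the power (n+1)^(-p/2), which
    cancels the logarithm subtracted from the odd harmonic sum. *)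
Lemma Rprod_limit (p q Delta : C) (HDelta : (Delta ^ 2 = p ^ 2 - 4 * q)%C) :
  is_Clim (Rprod p q) (Rconst p Delta).
Proof.
  assert (H : is_Clim (fun n => Rprod p q (S n)) (Rconst p Delta)).
  2:{ destruct H as [H1 H2]; split; apply is_lim_seq_incr_1; assumption. }
  set (a := (1 / 2 + p / 4 + Delta / 4)%C); set (b := (1 / 2 + p / 4 - Delta / 4)%C).
  apply is_Clim_ext with (fun n =>
    Cexp (- p * RtoC (odd_harmonic n - ln (INR (S n)) / 2)%R)
    * (gauss a n * (gauss b n * / gauss (1 / 2) n ^ 2)))%C.
  - intros n; rewrite (Rprod_eq p q Delta HDelta); fold a b; unfold gauss.
    assert (Hf : RtoC (INR (fact n)) <> 0%C)
      by (intros E; apply RtoC_inj in E; revert E; apply INR_fact_neq_0).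
    assert (Hr : rising (1 / 2) (S n) <> 0%C).
    { intros E; rewrite rising_half in E; apply RtoC_inj in E; pose proof (half_rising_pos (S n)); lra. }
    set (L := RtoC (ln (INR (S n)))).
    assert (E : Cexp (- p * odd_harmonic n) =
       (Cexp (- p * RtoC (odd_harmonic n - ln (INR (S n)) / 2)%R) * Cexp (- a * L) * Cexp (- b * L)
       / Cexp (- (1 / 2) * L) ^ 2)%C).
    { assert (E2 : (/ Cexp (- (1 / 2) * L) ^ 2)%C = Cexp L).
      { replace (Cexp (- (1 / 2) * L) ^ 2)%C with (Cexp (- (1 / 2) * L) * Cexp (- (1 / 2) * L))%C by ring.
        rewrite <- Cexp_plus, <- Cexp_opp; f_equal; field. }
      unfold Cdiv at 1; rewrite E2, <- !Cexp_plus; f_equal.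
      rewrite RtoC_minus, RtoC_div by lra; fold L; unfold a, b; field. }
    rewrite E; field; repeat split; auto; apply Cexp_neq_0.
  - replace (Rconst p Delta) with
      (Cexp (- p * RtoC (Euler_gamma / 2 + ln 2)%R) * (inv_Gamma a * (inv_Gamma b * PI)))%C.
    + apply is_Clim_mult; [| apply is_Clim_mult; [apply gauss_limit |];
        apply is_Clim_mult; [apply gauss_limit | apply gauss_half_limit]].
      apply is_Clim_Cexp, is_Clim_mult; [apply is_Clim_const |].
      apply is_Clim_RtoC, odd_harmonic_limit.
    + unfold Rconst; fold a b.
      replace (- p * RtoC (Euler_gamma / 2 + ln 2)%R)%C
        with (- p * ln 2 + - p * Euler_gamma / 2)%C
        by (rewrite RtoC_plus, RtoC_div by lra; field).
      rewrite Cexp_plus; ring.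
Qed.

(** * Bernoulli polynomials *)

Definition Csum (a : nat -> C) (n : nat) : C := sum_n (G := C_AbelianMonoid) a n.

Lemma Csum_O (a : nat -> C) : Csum a 0 = a O.
Proof. apply (sum_O (G := C_AbelianMonoid)). Qed.

Lemma Csum_S (a : nat -> C) (n : nat) : Csum a (S n) = (Csum a n + a (S n))%C.
Proof. apply (sum_Sn (G := C_AbelianMonoid)). Qed.

Lemma Csum_ext (a b : nat -> C) (n : nat) :
  (forall k, (k <= n)%nat -> a k = b k) -> Csum a n = Csum b n.
Proof. apply (sum_n_ext_loc (G := C_AbelianMonoid)). Qed.

Lemma Csum_plus (a b : nat -> C) (n : nat) :
  Csum (fun k => a k + b k)%C n = (Csum a n + Csum b n)%C.
Proof. apply (sum_n_plus (G := C_AbelianMonoid)). Qed.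

Lemma Csum_scal (c : C) (a : nat -> C) (n : nat) :
  Csum (fun k => c * a k)%C n = (c * Csum a n)%C.
Proof.
  induction n as [| n IH]; [rewrite !Csum_O | rewrite !Csum_S, IH]; ring.
Qed.

Lemma Csum_S_l (a : nat -> C) (n : nat) :
  Csum a (S n) = (a O + Csum (fun k => a (S k)) n)%C.
Proof.
  induction n as [| n IH].
  - rewrite Csum_S, !Csum_O; reflexivity.
  - rewrite Csum_S, IH, Csum_S; ring.
Qed.

Lemma Re_Csum (a : nat -> C) (n : nat) : Re (Csum a n) = sum_n (fun k => Re (a k)) n.
Proof.
  induction n as [| n IH].
  - rewrite Csum_O, sum_O; reflexivity.
  - rewrite Csum_S, sum_Sn, Re_plus, IH; reflexivity.
Qed.

Lemma Im_Csum (a : nat -> C) (n : nat) : Im (Csum a n) = sum_n (fun k => Im (a k)) n.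
Proof.
  induction n as [| n IH].
  - rewrite Csum_O, sum_O; reflexivity.
  - rewrite Csum_S, sum_Sn, Im_plus, IH; reflexivity.
Qed.

(** At a real argument the generating function thus becomes two real power series, to which
    uniqueness of coefficients applies. *)
Lemma is_series_C_parts (a : nat -> C) (l : C) :
  is_series (K := C_AbsRing) (V := C_NormedModule) a l ->
  is_series (fun n => Re (a n)) (Re l) /\ is_series (fun n => Im (a n)) (Im l).
Proof.
  intros H; split.
  - change (is_lim_seq (sum_n (fun n => Re (a n))) (Re l)).
    apply is_lim_seq_ext with (fun n => Re (Csum a n)); [apply Re_Csum |].
    intros P [eps HP]; apply (H (fun c => P (Re c))).
    exists eps; intros y [Hy _]; apply HP, Hy.
  - change (is_lim_seq (sum_n (fun n => Im (a n))) (Im l)).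
    apply is_lim_seq_ext with (fun n => Im (Csum a n)); [apply Im_Csum |].
    intros P [eps HP]; apply (H (fun c => P (Im c))).
    exists eps; intros y [_ Hy]; apply HP, Hy.
Qed.

(** * The exponential series near 0 *)

Lemma is_Cderive_monomial (w : C) (n : nat) (s : R) :
  is_Cderive (fun s => (w * s) ^ S n / INR (fact (S n)))%C s
    (w * ((w * s) ^ n / INR (fact n)))%C.
Proof.
  assert (Hf : forall k, RtoC (INR (fact k)) <> 0%C)
    by (intros k E; apply RtoC_inj in E; revert E; apply INR_fact_neq_0).
  assert (H1 : is_Cderive (fun s => w * RtoC s)%C s w).
  { eapply is_Cderive_eq.
    - apply is_Cderive_scal, is_Cderive_RtoC, (is_derive_id (K := R_AbsRing)).
    - unfold one; simpl; ring. }
  assert (H : is_Cderive (fun s => (w * s) ^ S n)%C s (w * (INR (S n) * (w * s) ^ n))%C).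
  { induction n as [| n IH].
    - eapply is_Cderive_eq; [eapply is_Cderive_ext; [| exact H1] |]; simpl; intros; ring.
    - eapply is_Cderive_eq.
      + apply (is_Cderive_mult (fun s => w * RtoC s)%C (fun s => (w * s) ^ S n)%C); [exact H1 | exact IH].
      + rewrite (S_INR (S n)), RtoC_plus; simpl Cpow; ring. }
  eapply is_Cderive_eq.
  - eapply is_Cderive_ext; [| apply (is_Cderive_scal (/ INR (fact (S n))) _ _ _ H)].
    intros t; simpl; unfold Cdiv; ring.
  - rewrite fact_simpl, mult_INR, RtoC_mult; field; split; [apply Hf |].
    intros E; apply RtoC_inj in E; revert E; apply not_0_INR; lia.
Qed.

(** Differentiation lowers the order by one, so the Taylor remainder of order n + 1 is an integral
    of the one of order n. *)
Lemma is_Cderive_exp_partial_sum (w : C) (n : nat) (s : R) :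
  is_Cderive (fun s => Csum (fun k => (w * s) ^ k / INR (fact k))%C (S n)) s
    (w * Csum (fun k => (w * s) ^ k / INR (fact k))%C n)%C.
Proof.
  induction n as [| n IH].
  - eapply is_Cderive_eq.
    + eapply is_Cderive_ext; [intros t; symmetry; rewrite Csum_S, Csum_O; reflexivity |].
      apply is_Cderive_plus; [| apply is_Cderive_monomial].
      eapply is_Cderive_ext; [| apply (is_Cderive_const 1)].
      intros t; simpl; field.
    + rewrite Csum_O; simpl; field.
  - eapply is_Cderive_eq.
    + eapply is_Cderive_ext; [intros t; symmetry; apply Csum_S |].
      apply is_Cderive_plus; [exact IH | apply is_Cderive_monomial].
    + rewrite Csum_S; ring.
Qed.

(* The bound carries no factorial, as [Cderive_bound] is applied once per order
   with the supremum over [0, 1]; it suffices near [w = 0]. *)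
Lemma Cexp_taylor (w : C) (n : nat) (s : R) : 0 <= s <= 1 ->
  Cmod (Cexp (w * s) - Csum (fun k => (w * s) ^ k / INR (fact k))%C n)
  <= exp (Cmod w) * (2 * Cmod w) ^ S n.
Proof.
  assert (H1 : forall s, is_Cderive (fun s => Cexp (w * s)) s (w * Cexp (w * s))%C).
  { intros r; eapply is_Cderive_eq.
    - apply (is_Cderive_Cexp (fun s => w * RtoC s)%C).
      apply is_Cderive_scal, is_Cderive_RtoC, (is_derive_id (K := R_AbsRing)).
    - unfold one; simpl; ring. }
  pose proof (Cmod_ge_0 w) as Hw.
  assert (B : forall s, 0 <= s <= 1 -> Cmod (Cexp (w * s)) <= exp (Cmod w)).
  { intros r Hr; rewrite Cmod_Cexp; apply exp_le.
    replace (Re (w * r)) with (Re w * r) by (destruct w; simpl; ring).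
    pose proof (re_le_Cmod w) as Hre; apply Rabs_le_between in Hre; nra. }
  (* One integration from 0 costs a factor 2 |w|, the 2 being that of [Cderive_bound]. *)
  assert (step : forall (f f' : R -> C) (M : R), f 0 = 0%C ->
    (forall s, 0 <= s <= 1 -> is_Cderive f s (w * f' s)%C) ->
    (forall s, 0 <= s <= 1 -> Cmod (f' s) <= M) ->
    forall s, 0 <= s <= 1 -> Cmod (f s) <= 2 * Cmod w * M).
  { intros f f' M H0 Hd HM r Hr.
    pose proof (Rle_trans _ _ _ (Cmod_ge_0 _) (HM 0 ltac:(lra))) as HM0.
    replace (f r) with (f r - f 0)%C by (rewrite H0; ring).
    apply Rle_trans with (2 * (Cmod w * M) * (r - 0)).
    - apply Cderive_bound with (fun s => w * f' s)%C; [lra |].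
      intros t Ht; split; [apply Hd; lra |].
      rewrite Cmod_mult; apply Rmult_le_compat_l; [exact Hw | apply HM; lra].
    - assert (0 <= Cmod w * M) by (apply Rmult_le_pos; assumption); nra. }
  revert s; induction n as [| n IH]; intros s Hs.
  - replace (exp (Cmod w) * (2 * Cmod w) ^ 1) with (2 * Cmod w * exp (Cmod w)) by ring.
    apply (step (fun s => Cexp (w * s) - Csum (fun k => (w * s) ^ k / INR (fact k)) 0)%C
      (fun s => Cexp (w * s))); auto.
    + rewrite Csum_O, Cmult_0_r, Cexp_0; simpl; field.
    + intros r _; eapply is_Cderive_eq.
      * apply is_Cderive_minus; [apply H1 |].
        eapply is_Cderive_ext; [| apply (is_Cderive_const 1)].
        intros t; rewrite Csum_O; simpl; field.
      * ring.
  - replace (exp (Cmod w) * (2 * Cmod w) ^ S (S n))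
      with (2 * Cmod w * (exp (Cmod w) * (2 * Cmod w) ^ S n)) by (simpl; ring).
    apply (step (fun s => Cexp (w * s) - Csum (fun k => (w * s) ^ k / INR (fact k)) (S n))%C
      (fun s => Cexp (w * s) - Csum (fun k => (w * s) ^ k / INR (fact k)) n)%C); auto.
    + rewrite Csum_S_l, Cmult_0_r, Cexp_0.
      rewrite (Csum_ext _ (fun _ => 0 * 0)%C), Csum_scal by (intros; simpl; unfold Cdiv; ring).
      simpl; field.
    + intros r _; eapply is_Cderive_eq.
      * apply is_Cderive_minus; [apply H1 | apply is_Cderive_exp_partial_sum].
      * ring.
Qed.

Lemma Cexp_series (w : C) : 2 * Cmod w < 1 ->
  is_Clim (Csum (fun k => w ^ k / INR (fact k))%C) (Cexp w).
Proof.
  intros Hw; pose proof (Cmod_ge_0 w).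
  apply is_Clim_bound with (fun n => exp (Cmod w) * (2 * Cmod w) ^ S n).
  - exists O; intros n _; rewrite Cmod_minus_sym.
    pose proof (Cexp_taylor w n 1 ltac:(lra)) as H'.
    rewrite Cmult_1_r in H'; exact H'.
  - replace (Finite 0) with (Finite (exp (Cmod w) * 0)) by (f_equal; ring).
    apply is_lim_seq_mult'; [apply is_lim_seq_const |].
    apply (is_lim_seq_incr_1 (fun n => (2 * Cmod w) ^ n)), is_lim_seq_geom.
    rewrite Rabs_right; lra.
Qed.

(** * Coefficients of real power series *)

Lemma CV_radius_ge (a : nat -> R) (x : R) :
  ex_pseries a x -> Rbar_le (Rabs x) (CV_radius a).
Proof.
  intros [l H]; apply is_pseries_R in H.
  destruct (CV_radius_bounded a) as [Hub _]; apply Hub.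
  destruct (filterlim_bounded (K := R_AbsRing) (V := R_NormedModule) (fun n => a n * x ^ n)) as [M HM].
  - exists 0; apply ex_series_lim_0; exists l; exact H.
  - exists M; intros n; specialize (HM n); unfold norm in HM; simpl in HM; unfold abs in HM; simpl in HM.
    rewrite Rabs_mult, <- RPow_abs, Rabs_Rabsolu, RPow_abs, <- Rabs_mult; exact HM.
Qed.

(** Convergence is used at the midpoint of |x| and r, which exceeds |x| and is never 0, the one
    point where nothing is assumed. *)
Lemma CV_radius_gt (a : nat -> R) (r x : R) :
  (forall y, 0 < Rabs y < r -> ex_pseries a y) -> Rabs x < r ->
  Rbar_lt (Rabs x) (CV_radius a).
Proof.
  intros H Hx; pose proof (Rabs_pos x).
  assert (Hy : Rabs ((Rabs x + r) / 2) = (Rabs x + r) / 2) by (apply Rabs_right; lra).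
  eapply Rbar_lt_le_trans; [| apply (CV_radius_ge a ((Rabs x + r) / 2)), H; rewrite Hy; lra].
  rewrite Hy; simpl; lra.
Qed.

(** The point 0 is excluded because x / (e^x - 1) has no meaningful value there; equality of the
    constant terms stands in for it. *)
Lemma pseries_coef_unique (a b : nat -> R) (r : R) : 0 < r ->
  (forall x, 0 < Rabs x < r -> exists l, is_pseries a x l /\ is_pseries b x l) ->
  a O = b O -> forall n, a n = b n.
Proof.
  intros Hr H H0 n.
  assert (Ha : forall x, 0 < Rabs x < r -> ex_pseries a x)
    by (intros x Hx; destruct (H x Hx) as [l [H1 _]]; exists l; exact H1).
  assert (Hb : forall x, 0 < Rabs x < r -> ex_pseries b x)
    by (intros x Hx; destruct (H x Hx) as [l [_ H1]]; exists l; exact H1).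
  assert (R0 : Rabs 0 < r) by (rewrite Rabs_R0; exact Hr).
  apply PSeries_ext_recip.
  - pose proof (CV_radius_gt a r 0 Ha R0) as L; rewrite Rabs_R0 in L; exact L.
  - pose proof (CV_radius_gt b r 0 Hb R0) as L; rewrite Rabs_R0 in L; exact L.
  - exists (mkposreal r Hr); intros x Hx.
    unfold ball in Hx; simpl in Hx; unfold AbsRing_ball, abs, minus, plus, opp in Hx; simpl in Hx.
    rewrite Ropp_0, Rplus_0_r in Hx.
    destruct (Req_dec x 0) as [-> | Hx0].
    + rewrite !PSeries_0; exact H0.
    + destruct (H x) as [l [H1 H2]]; [split; [apply Rabs_pos_lt |]; assumption |].
      rewrite (is_pseries_unique _ _ _ H1), (is_pseries_unique _ _ _ H2); reflexivity.
Qed.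

Lemma is_pseries_monomial (c : R) (k : nat) (x : R) :
  is_pseries (fun n => if Nat.eqb n k then c else 0) x (c * x ^ k).
Proof.
  apply is_pseries_R.
  change (is_lim_seq (sum_n (fun n => (if Nat.eqb n k then c else 0) * x ^ n)) (c * x ^ k)).
  assert (E : forall n, sum_n (fun n => (if Nat.eqb n k then c else 0) * x ^ n) n
     = if Nat.leb k n then c * x ^ k else 0).
  { induction n as [| n IH].
    - rewrite sum_O; destruct k; simpl; ring.
    - rewrite sum_Sn, IH; match goal with |- plus ?a ?b = ?c => change (@eq R (a + b) c) end.
      destruct (Nat.leb_spec k n), (Nat.eqb_spec (S n) k); subst; try lia.
      + replace (Nat.leb k (S n)) with true by (symmetry; apply Nat.leb_le; lia). ring.
      + replace (Nat.leb (S n) (S n)) with true by (symmetry; apply Nat.leb_le; lia); ring.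
      + replace (Nat.leb k (S n)) with false by (symmetry; apply Nat.leb_gt; lia); ring. }
  apply is_lim_seq_ext_loc with (fun _ => c * x ^ k); [| apply is_lim_seq_const].
  exists k; intros n Hn; rewrite E.
  replace (Nat.leb k n) with true by (symmetry; apply Nat.leb_le; lia); reflexivity.
Qed.

Lemma is_pseries_reflect (a : nat -> R) (x l : R) :
  is_pseries a (- x) l -> is_pseries (fun n => (-1) ^ n * a n) x l.
Proof.
  intros H; apply is_pseries_R in H; apply is_pseries_R.
  eapply is_series_ext; [| exact H].
  intros n; simpl; replace (- x) with (-1 * x) by ring; rewrite Rpow_mult_distr; ring.
Qed.

(** * Divided Bernoulli polynomials and their recurrence *)

Definition bern (B : nat -> C -> C) (t : C) (n : nat) : C := (B n t / INR (fact n))%C.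

Lemma bern_series (B : nat -> C -> C) (HB : is_Bernoulli_polynomials B) (t : C) (x : R) : 0 < Rabs x < 1 ->
  is_pseries (fun n => Re (bern B t n)) x (x / (exp x - 1) * Re (Cexp (t * x))) /\
  is_pseries (fun n => Im (bern B t n)) x (x / (exp x - 1) * Im (Cexp (t * x))).
Proof.
  intros [Hx0 Hx1].
  assert (Hx : x <> 0) by (intros ->; rewrite Rabs_R0 in Hx0; lra).
  assert (He : exp x - 1 <> 0).
  { intros E; apply Hx, exp_inv; rewrite exp_0; lra. }
  destruct (is_series_C_parts _ _ (HB t (RtoC x) (fun E => Hx (RtoC_inj _ _ E))
    ltac:(rewrite Cmod_R; pose proof PI2_1; lra))) as [H1 H2].
  replace (x * Cexp (t * x) / (Cexp x - 1))%C
    with (RtoC (x / (exp x - 1)) * Cexp (t * x))%C in H1, H2.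
  2: rewrite Cexp_RtoC, <- RtoC_minus, RtoC_div by exact He; field;
       intros E; apply RtoC_inj in E; lra.
  rewrite re_scal_l in H1; rewrite im_scal_l in H2.
  split; apply is_pseries_R; eapply is_series_ext; try eassumption;
    intros n; cbv beta; rewrite <- RtoC_pow, <- RtoC_div by apply INR_fact_neq_0;
    unfold bern, Cdiv; rewrite <- RtoC_inv by apply INR_fact_neq_0.
  - rewrite !re_scal_r; match goal with |- ?a = ?b => change (@eq R a b) end.
    field; apply INR_fact_neq_0.
  - rewrite !im_scal_r; match goal with |- ?a = ?b => change (@eq R a b) end.
    field; apply INR_fact_neq_0.
Qed.

Lemma is_series_Clim (a : nat -> C) (l : C) : is_Clim (Csum a) l ->
  is_series (fun n => Re (a n)) (Re l) /\ is_series (fun n => Im (a n)) (Im l).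
Proof.
  intros [H1 H2]; split.
  - change (is_lim_seq (sum_n (fun n => Re (a n))) (Re l)).
    eapply is_lim_seq_ext; [apply Re_Csum | exact H1].
  - change (is_lim_seq (sum_n (fun n => Im (a n))) (Im l)).
    eapply is_lim_seq_ext; [apply Im_Csum | exact H2].
Qed.

Lemma exp_pseries (t : C) (x : R) : 2 * Cmod t * Rabs x < 1 ->
  is_pseries (fun n => Re (t ^ n) / INR (fact n)) x (Re (Cexp (t * x))) /\
  is_pseries (fun n => Im (t ^ n) / INR (fact n)) x (Im (Cexp (t * x))).
Proof.
  intros Hx; destruct (is_series_Clim _ _ (Cexp_series (t * x) ltac:(rewrite Cmod_mult, Cmod_R; lra))) as [H1 H2].
  split; apply is_pseries_R.
  - eapply is_series_ext; [| exact H1].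
    intros n; cbv beta; rewrite Cpow_mult_l, <- RtoC_pow; unfold Cdiv.
    rewrite <- RtoC_inv by apply INR_fact_neq_0; rewrite !re_scal_r; unfold Rdiv.
    match goal with |- ?a = ?b => change (@eq R a b) end; ring.
  - eapply is_series_ext; [| exact H2].
    intros n; cbv beta; rewrite Cpow_mult_l, <- RtoC_pow; unfold Cdiv.
    rewrite <- RtoC_inv by apply INR_fact_neq_0; rewrite !im_scal_r; unfold Rdiv.
    match goal with |- ?a = ?b => change (@eq R a b) end; ring.
Qed.

(* Compares coefficients in (e^x - 1) sum b_n x^n = x sum e_n x^n. *)
Lemma cauchy_product_recurrence (b e : nat -> R) (g : R -> R) (r : R) : 0 < r -> r <= 1 ->
  (forall x, 0 < Rabs x < r -> is_pseries b x (x / (exp x - 1) * g x)) ->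
  (forall x, 0 < Rabs x < r -> is_pseries e x (g x)) ->
  forall m, sum_n (fun k => b k / INR (fact (S m - k))) m = e m.
Proof.
  intros Hr Hr1 Hb He m.
  set (c := PS_minus (fun n => / INR (fact n)) (fun n => if Nat.eqb n 0 then 1 else 0)).
  assert (Hc : forall x, is_pseries c x (exp x - 1)).
  { intros x; unfold Rminus; apply (is_pseries_minus (K := R_AbsRing) (V := R_NormedModule));
      [apply is_exp_Reals |].
    pose proof (is_pseries_monomial 1 0 x) as H; simpl in H; rewrite Rmult_1_r in H; exact H. }
  assert (E : forall n, PS_mult b c n = PS_incr_1 e n).
  { apply (pseries_coef_unique _ _ r Hr).
    - intros x Hx; exists (x * g x); split.
      + replace (x * g x) with (x / (exp x - 1) * g x * (exp x - 1)).
        * apply is_pseries_mult; auto.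
          -- apply CV_radius_gt with r; [intros y Hy; eexists; apply Hb, Hy | apply Hx].
          -- apply CV_radius_gt with r; [intros y Hy; eexists; apply Hc | apply Hx].
        * assert (x <> 0) by (intros ->; rewrite Rabs_R0 in Hx; lra).
          field; intros E; apply H, exp_inv; rewrite exp_0; lra.
      + apply (is_pseries_incr_1 (K := R_AbsRing) (V := R_NormedModule)), He, Hx.
    - unfold PS_mult, c, PS_minus, PS_plus, PS_opp, PS_incr_1, plus, opp, zero; simpl.
      field. }
  (* The factor x shifts the right side by one index; on the left the term k = m + 1 drops because
     e^x - 1 has no constant term. *)
  specialize (E (S m)); simpl PS_incr_1 in E; rewrite <- E.
  unfold PS_mult; rewrite tech5, Nat.sub_diag.
  replace (c O) with 0 by (unfold c, PS_minus, PS_plus, PS_opp, plus, opp; simpl; field).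
  rewrite Rmult_0_r, Rplus_0_r, <- sum_n_Reals.
  apply sum_n_ext_loc; intros k Hk.
  replace (S m - k)%nat with (S (m - k)) by lia.
  match goal with |- _ = ?r => change r with (b k * (/ INR (fact (S (m - k))) + - 0)) end.
  match goal with |- ?x = ?y => change (@eq R x y) end.
  unfold Rdiv; ring.
Qed.

Lemma bern_recurrence (B : nat -> C -> C) (HB : is_Bernoulli_polynomials B) (t : C) (m : nat) :
  Csum (fun k => bern B t k / INR (fact (S m - k)))%C m = (t ^ m / INR (fact m))%C.
Proof.
  pose proof (Cmod_ge_0 t) as Ht.
  (* Small enough for the exponential series in t x, which asks for 2 |t| |x| < 1, and for
     [bern_series], which asks for |x| < 1. *)
  set (r := / (2 * Cmod t + 1)).
  assert (Hr : 0 < r) by (apply Rinv_0_lt_compat; lra).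
  assert (Hr1 : r <= 1) by (unfold r; rewrite <- Rinv_1; apply Rinv_le_contravar; lra).
  assert (Hx : forall x, 0 < Rabs x < r -> 2 * Cmod t * Rabs x < 1).
  { intros x [H1 H2]; apply Rmult_lt_compat_l with (r := 2 * Cmod t + 1) in H2; [| lra].
    unfold r in H2; rewrite Rinv_r in H2 by lra; lra. }
  assert (Hf : forall z k, (z / RtoC (INR (fact k)))%C = (z * RtoC (/ INR (fact k)))%C)
    by (intros; unfold Cdiv; rewrite RtoC_inv by apply INR_fact_neq_0; reflexivity).
  apply C_ext; [rewrite Re_Csum, Hf, re_scal_r | rewrite Im_Csum, Hf, im_scal_r].
  - etransitivity; [| apply (cauchy_product_recurrence (fun n => Re (bern B t n))
      (fun n => Re (t ^ n) / INR (fact n)) (fun x => Re (Cexp (t * x))) r Hr Hr1)].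
    + apply sum_n_ext; intros n; rewrite Hf, re_scal_r; reflexivity.
    + intros x H; apply (proj1 (bern_series B HB t x ltac:(lra))).
    + intros x H; apply (proj1 (exp_pseries t x (Hx x H))).
  - etransitivity; [| apply (cauchy_product_recurrence (fun n => Im (bern B t n))
      (fun n => Im (t ^ n) / INR (fact n)) (fun x => Im (Cexp (t * x))) r Hr Hr1)].
    + apply sum_n_ext; intros n; rewrite Hf, im_scal_r; reflexivity.
    + intros x H; apply (proj2 (bern_series B HB t x ltac:(lra))).
    + intros x H; apply (proj2 (exp_pseries t x (Hx x H))).
Qed.

(** Comparing coefficients makes each odd one, except that of x, equal to its own negative. *)
Lemma odd_coef_zero (b : nat -> R) (f : R -> R) (c : R) :
  (forall x, 0 < Rabs x < 1 -> is_pseries b x (f x)) ->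
  (forall x, 0 < Rabs x < 1 -> f (- x) = f x + c * x) ->
  forall n, Nat.odd n = true -> n <> 1%nat -> b n = 0.
Proof.
  intros Hb Hf n Hodd Hn1.
  pose proof (pseries_coef_unique (fun n => (-1) ^ n * b n)
    (PS_plus b (fun n => if Nat.eqb n 1 then c else 0)) 1 Rlt_0_1) as U.
  specialize (U ltac:(intros x Hx; exists (f x + c * x); split;
    [rewrite <- Hf by exact Hx; apply is_pseries_reflect, Hb; rewrite Rabs_Ropp; exact Hx
    | apply (is_pseries_plus (K := R_AbsRing) (V := R_NormedModule)); [apply Hb, Hx |];
      pose proof (is_pseries_monomial c 1 x) as H; rewrite pow_1 in H; exact H])
    ltac:(unfold PS_plus, plus; simpl; ring) n).
  unfold PS_plus, plus in U; simpl in U.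
  destruct (Nat.eqb_spec n 1); [contradiction |].
  apply Nat.odd_spec in Hodd; destruct Hodd as [k ->].
  rewrite Nat.add_1_r, pow_1_odd in U; rewrite Nat.add_1_r; lra.
Qed.

(** x / (e^x - 1) grows by x under x -> -x. The values at 0 are not known beforehand to be real, so
    the imaginary parts are treated too, with the zero function. *)
Lemma bern_odd (B : nat -> C -> C) (HB : is_Bernoulli_polynomials B) (n : nat) : Nat.odd n = true -> n <> 1%nat -> bern B 0 n = 0%C.
Proof.
  intros Hodd Hn1.
  assert (E0 : forall x, Cexp (0 * RtoC x) = 1%C) by (intros; rewrite Cmult_0_l; apply Cexp_0).
  apply C_ext.
  - apply (odd_coef_zero (fun n => Re (bern B 0 n)) (fun x => x / (exp x - 1)) 1); auto.
    + intros x Hx; destruct (bern_series B HB 0 x Hx) as [H _].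
      rewrite E0, re_RtoC, Rmult_1_r in H; exact H.
    + intros x Hx; rewrite exp_Ropp.
      assert (x <> 0) by (intros ->; rewrite Rabs_R0 in Hx; lra).
      assert (exp x - 1 <> 0).
      { intros E; apply H, exp_inv; rewrite exp_0; lra. }
      pose proof (exp_pos x); field; repeat split; lra.
  - apply (odd_coef_zero (fun n => Im (bern B 0 n)) (fun x => 0) 0); auto.
    + intros x Hx; destruct (bern_series B HB 0 x Hx) as [_ H].
      rewrite E0, im_RtoC, Rmult_0_r in H; exact H.
    + intros; ring.
Qed.

Local Open Scope C_scope.

Lemma RtoC_fact_neq_0 (k : nat) : RtoC (INR (fact k)) <> 0.
Proof. intros E; apply RtoC_inj in E; revert E; apply INR_fact_neq_0. Qed.

Lemma RtoC_INR_S_neq_0 (k : nat) : RtoC (INR (S k)) <> 0.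
Proof. intros E; apply RtoC_inj in E; revert E; apply not_0_INR; lia. Qed.

Lemma bern_0 (B : nat -> C -> C) (HB : is_Bernoulli_polynomials B) (t : C) : bern B t 0 = 1.
Proof.
  pose proof (bern_recurrence B HB t 0) as H; rewrite Csum_O in H; simpl in H.
  replace (bern B t 0) with (bern B t 0 / 1) by field; rewrite H; field.
Qed.

Lemma bern_1 (B : nat -> C -> C) (HB : is_Bernoulli_polynomials B) (t : C) :
  bern B t 1 = t - 1 / 2.
Proof.
  pose proof (bern_recurrence B HB t 1) as H.
  rewrite Csum_S, Csum_O, (bern_0 B HB) in H; cbn [Nat.sub fact] in H.
  simpl in H; replace (1 + 1)%R with 2%R in H by ring.
  replace (bern B t 1) with (1 / 2 + bern B t 1 / 1 - 1 / 2) by field.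
  rewrite H; field.
Qed.

Lemma fact_values : INR (fact 0) = 1%R /\ INR (fact 1) = 1%R /\ INR (fact 2) = 2%R
  /\ INR (fact 3) = 6%R /\ INR (fact 4) = 24%R /\ INR (fact 5) = 120%R.
Proof. repeat split; rewrite INR_IZR_INZ; reflexivity. Qed.

Lemma bern_values (B : nat -> C -> C) (HB : is_Bernoulli_polynomials B) (t : C) :
  bern B t 2 = t ^ 2 / 2 - t / 2 + 1 / 12 /\
  bern B t 3 = t ^ 3 / 6 - t ^ 2 / 4 + t / 12 /\
  bern B t 4 = t ^ 4 / 24 - t ^ 3 / 12 + t ^ 2 / 24 - 1 / 720.
Proof.
  destruct fact_values as (F0 & F1 & F2 & F3 & F4 & F5).
  assert (H2 : bern B t 2 = t ^ 2 / 2 - t / 2 + 1 / 12).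
  { pose proof (bern_recurrence B HB t 2) as H.
    rewrite !Csum_S, Csum_O, (bern_0 B HB), (bern_1 B HB) in H; cbn [Nat.sub] in H.
    rewrite F1, F2, F3 in H.
    match type of H with ?x = _ =>
      replace (bern B t 2) with (x - (1 / 6 + (t - 1 / 2) / 2)) by field end.
    rewrite H; field. }
  assert (H3 : bern B t 3 = t ^ 3 / 6 - t ^ 2 / 4 + t / 12).
  { pose proof (bern_recurrence B HB t 3) as H.
    rewrite !Csum_S, Csum_O, (bern_0 B HB), (bern_1 B HB), H2 in H; cbn [Nat.sub] in H.
    rewrite F1, F2, F3, F4 in H.
    match type of H with ?x = _ =>
      replace (bern B t 3) with (x - (1 / 24 + (t - 1 / 2) / 6 + (t ^ 2 / 2 - t / 2 + 1 / 12) / 2))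
        by field end.
    rewrite H; field. }
  split; [exact H2 | split; [exact H3 |]].
  pose proof (bern_recurrence B HB t 4) as H.
  rewrite !Csum_S, Csum_O, (bern_0 B HB), (bern_1 B HB), H2, H3 in H; cbn [Nat.sub] in H.
  rewrite F1, F2, F3, F4, F5 in H.
  match type of H with ?x = _ =>
    replace (bern B t 4) with (x - (1 / 120 + (t - 1 / 2) / 24 + (t ^ 2 / 2 - t / 2 + 1 / 12) / 6
      + (t ^ 3 / 6 - t ^ 2 / 4 + t / 12) / 2)) by field end.
  rewrite H; field.
Qed.

(* [bern B 0 k'] is the coefficient of the derivative of the (k'+1)-st divided
   Bernoulli polynomial at 0, so that [delta] collects, for t = u and t = v, the
   part of that polynomial of degree at least 2 in t. *)
Definition delta (B : nat -> C -> C) (u v : C) (k : nat) : C :=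
  match k with
  | O => 0
  | S k' => bern B u k + bern B v k - 2 * bern B 0 k - (u + v) * bern B 0 k'
  end.

(** In the combination of the Bernoulli recurrences at u, v and 0 the parts of degree 0 and 1 in u,
    v cancel; what remains are the power sums found in log (1 + s u) + log (1 + s v). *)
Lemma delta_recurrence (B : nat -> C -> C) (HB : is_Bernoulli_polynomials B) (u v : C) (m : nat) :
  Csum (fun k => delta B u v (S (S k)) / INR (fact (S m - k))) m =
    (u ^ S (S m) + v ^ S (S m)) / INR (fact (S (S m))).
Proof.
  assert (Z : forall k, 0 ^ S k = 0) by (intros; simpl; ring).
  assert (S1 : forall t, Csum (fun k => bern B t (S (S k)) / INR (fact (S m - k))) m =
    t ^ S (S m) / INR (fact (S (S m))) - 1 / INR (fact (S (S (S m))))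
      - (t - 1 / 2) / INR (fact (S (S m)))).
  { intros t; pose proof (bern_recurrence B HB t (S (S m))) as H.
    rewrite !Csum_S_l, (bern_0 B HB), (bern_1 B HB) in H.
    rewrite <- H; cbn [Nat.sub]; unfold Cdiv; ring. }
  assert (S0 : Csum (fun k => bern B 0 (S k) / INR (fact (S m - k))) m = - 1 / INR (fact (S (S m)))).
  { pose proof (bern_recurrence B HB 0 (S m)) as H.
    rewrite !Csum_S_l, (bern_0 B HB), Z in H; cbn [Nat.sub] in H.
    match type of H with _ + ?x = ?y =>
      transitivity x; [reflexivity |]; transitivity (y - 1 / INR (fact (S (S m)))) end.
    - rewrite <- H; ring.
    - unfold Cdiv; ring. }
  rewrite (Csum_ext _ (fun k => (bern B u (S (S k)) / INR (fact (S m - k))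
      + bern B v (S (S k)) / INR (fact (S m - k)))
      + (- (2) * (bern B 0 (S (S k)) / INR (fact (S m - k)))
         + - (u + v) * (bern B 0 (S k) / INR (fact (S m - k)))))).
  - rewrite !Csum_plus, !Csum_scal, !S1, S0, Z; field; split; apply RtoC_fact_neq_0.
  - intros k _; unfold delta, Cdiv; ring.
Qed.

(** A single formula for all j = i + 1. It puts the sign (-1)^j on p B_j / (2 j); for j >= 2 this is
    harmless since B_j = 0 for odd j >= 3, and for j = 1 it yields the separately stated b_1. *)
Lemma bcoef_delta (B : nat -> C -> C) (HB : is_Bernoulli_polynomials B) (p q Delta : C)
    (HDelta : Delta ^ 2 = p ^ 2 - 4 * q) (i : nat) :
  bcoef B p q Delta (S i) =
    (- 1) ^ i * INR (fact i) * delta B (p / 4 + Delta / 4) (p / 4 - Delta / 4) (S (S i)).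
Proof.
  set (u := p / 4 + Delta / 4); set (v := p / 4 - Delta / 4).
  assert (Huv : u + v = p / 2) by (unfold u, v; field).
  unfold delta; rewrite Huv.
  destruct i as [| i].
  - destruct (bern_values B HB u) as [-> _], (bern_values B HB v) as [-> _],
      (bern_values B HB 0) as [-> _].
    rewrite (bern_1 B HB); unfold bcoef, u, v; simpl.
    replace q with ((p ^ 2 - Delta ^ 2) / 4) by (rewrite HDelta; field); simpl; field.
  - unfold bcoef; cbn [Nat.eqb]; fold u v.
    replace (S (S i) + 1)%nat with (S (S (S i))) by lia.
    assert (HB' : forall t k, B k t = bern B t k * INR (fact k)).
    { intros t k; unfold bern; field; apply RtoC_fact_neq_0. }
    rewrite !HB'.
    assert (Hpar : bern B 0 (S (S i)) = (- 1) ^ i * bern B 0 (S (S i))).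
    { destruct (Nat.Even_or_Odd i) as [[k ->] | [k ->]].
      - replace ((- 1) ^ (2 * k)) with (RtoC 1); [ring |].
        rewrite <- RtoC_pow, pow_1_even; reflexivity.
      - rewrite (bern_odd B HB) by (try lia; apply Nat.odd_spec; exists (S k); lia); ring. }
    rewrite Hpar at 1.
    rewrite !(fact_simpl (S i)), !(fact_simpl (S (S i))), !(fact_simpl (S i)), !(fact_simpl i), !mult_INR, !RtoC_mult.
    replace (INR (S (S i)) + 1)%C with (RtoC (INR (S (S (S i)))))
      by (rewrite (S_INR (S (S i))), RtoC_plus; reflexivity).
    simpl Cpow; field; repeat split; try apply RtoC_INR_S_neq_0.
Qed.

Lemma bcoef_values (B : nat -> C -> C) (HB : is_Bernoulli_polynomials B) (p q Delta : C)
    (HDelta : Delta ^ 2 = p ^ 2 - 4 * q) :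
  bcoef B p q Delta 2 =
    - p ^ 3 / 48 + p * q / 16 + p ^ 2 / 16 - q / 8
  /\
  bcoef B p q Delta 3 =
    p ^ 4 / 192 - p ^ 2 * q / 48 + q ^ 2 / 96
    - p ^ 3 / 48 + p * q / 16 + p ^ 2 / 48 - q / 24.
Proof.
  assert (Hq : q = (p ^ 2 - Delta ^ 2) / 4) by (rewrite HDelta; field).
  destruct fact_values as (_ & F1 & F2 & _).
  rewrite !(bcoef_delta B HB p q Delta HDelta); unfold delta; rewrite F1, F2.
  destruct (bern_values B HB (p / 4 + Delta / 4)) as (_ & -> & ->),
    (bern_values B HB (p / 4 - Delta / 4)) as (_ & -> & ->),
    (bern_values B HB 0) as (-> & -> & ->).
  rewrite Hq; split; field.
Qed.

(** * Expansions at 0 *)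

(** One-sided, as s stands for 1 / (n + 1/2); s0 <= 1 allows a spare factor s to be dropped. *)
Definition bigO (k : nat) (f : R -> C) : Prop :=
  exists K s0 : R, (0 < s0)%R /\ (s0 <= 1)%R /\ (0 <= K)%R /\
    forall s, (0 <= s <= s0)%R -> (Cmod (f s) <= K * s ^ k)%R.

Lemma bigO_ext (k : nat) (f g : R -> C) (r : R) : (0 < r)%R ->
  (forall s, (0 <= s <= r)%R -> f s = g s) -> bigO k f -> bigO k g.
Proof.
  intros Hr E (K & s0 & H0 & H1 & HK & H); exists K, (Rmin s0 r).
  split; [apply Rmin_pos; assumption |].
  split; [eapply Rle_trans; [apply Rmin_l | exact H1] |].
  split; [exact HK |]; intros s Hs.
  pose proof (Rmin_l s0 r); pose proof (Rmin_r s0 r).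
  rewrite <- E by lra; apply H; lra.
Qed.

Lemma bigO_plus (k : nat) (f g : R -> C) :
  bigO k f -> bigO k g -> bigO k (fun s => f s + g s).
Proof.
  intros (K & s0 & H0 & H1 & HK & H) (K' & s0' & H0' & H1' & HK' & H').
  exists (K + K')%R, (Rmin s0 s0').
  split; [apply Rmin_pos; assumption |].
  split; [eapply Rle_trans; [apply Rmin_l | exact H1] |].
  split; [lra |]; intros s Hs.
  pose proof (Rmin_l s0 s0'); pose proof (Rmin_r s0 s0').
  eapply Rle_trans; [apply Cmod_triangle |].
  specialize (H s ltac:(lra)); specialize (H' s ltac:(lra)); lra.
Qed.

Lemma bigO_scal (k : nat) (c : C) (f : R -> C) : bigO k f -> bigO k (fun s => c * f s).
Proof.
  intros (K & s0 & H0 & H1 & HK & H); pose proof (Cmod_ge_0 c).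
  exists (Cmod c * K)%R, s0.
  split; [exact H0 | split; [exact H1 | split; [apply Rmult_le_pos; assumption |]]].
  intros s Hs; rewrite Cmod_mult, Rmult_assoc.
  apply Rmult_le_compat_l; [assumption | apply H, Hs].
Qed.

Lemma bigO_0 (k : nat) : bigO k (fun _ => 0).
Proof.
  exists 0%R, 1%R; repeat split; try lra; intros s _; rewrite Cmod_0; lra.
Qed.

Lemma bigO_Csum (k n : nat) (f : nat -> R -> C) :
  (forall i, bigO k (f i)) -> bigO k (fun s => Csum (fun i => f i s) n).
Proof.
  intros H; induction n as [| n IH].
  - apply (bigO_ext k (f O) _ 1 Rlt_0_1); [intros; rewrite Csum_O; reflexivity | apply H].
  - apply (bigO_ext k (fun s => Csum (fun i => f i s) n + f (S n) s) _ 1 Rlt_0_1);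
      [intros; rewrite Csum_S; reflexivity | apply bigO_plus; auto].
Qed.

(** Taylor coefficients of log (1 + s u) in s. *)
Definition log_coef (u : C) (m : nat) : C :=
  match m with O => 0 | S m' => (- 1) ^ m' * u ^ m / INR m end.

Lemma log_partial_derive (u : C) (n : nat) (s : R) :
  is_Cderive (fun s => Csum (fun m => log_coef u m * s ^ m) n) s
    (match n with O => 0 | S n' => Csum (fun m => u * (- (s * u)) ^ m) n' end).
Proof.
  assert (M : forall m, is_Cderive (fun s => RtoC s ^ S m) s (INR (S m) * s ^ m)).
  { intros m; eapply is_Cderive_ext; [intros t; apply RtoC_pow |].
    eapply is_Cderive_eq.
    - apply is_Cderive_RtoC, (is_derive_pow (fun x => x) (S m) s 1), (is_derive_id (K := R_AbsRing)).
    - rewrite !RtoC_mult, RtoC_pow; simpl Nat.pred; ring. }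
  assert (T : forall m, is_Cderive (fun s => log_coef u (S m) * s ^ S m) s (u * (- (s * u)) ^ m)).
  { intros m; eapply is_Cderive_eq; [apply is_Cderive_scal, M |].
    replace (- (s * u)) with ((- 1) * (s * u)) by ring; rewrite !Cpow_mult_l.
    unfold log_coef; rewrite (Cpow_S u m); field; apply RtoC_INR_S_neq_0. }
  induction n as [| n IH].
  - eapply is_Cderive_ext; [| apply (is_Cderive_const 0)].
    intros t; rewrite Csum_O; simpl; ring.
  - eapply is_Cderive_eq.
    + eapply is_Cderive_ext; [intros t; symmetry; apply Csum_S |].
      apply is_Cderive_plus; [exact IH | apply T].
    + destruct n; [rewrite Csum_O; simpl; ring | rewrite Csum_S; reflexivity].
Qed.

Lemma Csum_geometric (w : C) (n : nat) : (1 - w) * Csum (fun m => w ^ m) n = 1 - w ^ S n.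
Proof.
  induction n as [| n IH].
  - rewrite Csum_O; simpl; ring.
  - rewrite Csum_S, Cmult_plus_distr_l, IH; simpl; ring.
Qed.

Lemma Clog1p_0 : Clog1p 0 = 0.
Proof.
  unfold Clog1p; apply C_ext; simpl.
  - replace ((1 + 0) * ((1 + 0) * 1) + 0 * (0 * 1))%R with 1%R by ring; rewrite ln_1; field.
  - replace (0 / (1 + 0))%R with 0%R by field; apply atan_0.
Qed.

(** Keeps 1 + s u within 1/2 of 1, where the principal logarithm is smooth and 1 / |1 + s u| <=
    2. *)
Lemma small_radius (u : C) : exists s0 : R, (0 < s0 <= 1)%R /\
  forall s, (0 <= s <= s0)%R -> (Cmod (s * u) <= 1 / 2)%R.
Proof.
  pose proof (Cmod_ge_0 u).
  exists (/ (2 * Cmod u + 1))%R; repeat split.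
  - apply Rinv_0_lt_compat; lra.
  - rewrite <- Rinv_1; apply Rinv_le_contravar; lra.
  - intros s Hs; rewrite Cmod_mult, Cmod_R, Rabs_right by lra.
    assert (s * (2 * Cmod u + 1) <= 1)%R.
    { apply Rle_trans with (/ (2 * Cmod u + 1) * (2 * Cmod u + 1))%R.
      - apply Rmult_le_compat_r; lra.
      - rewrite Rinv_l; lra. }
    lra.
Qed.

Lemma Re_gt_m1 (w : C) : (Cmod w <= 1 / 2)%R -> (-1 < Re w)%R.
Proof.
  intros H; pose proof (re_le_Cmod w) as H'; apply Rabs_le_between in H'; lra.
Qed.

(** The remainder vanishes at 0, and by the geometric sum its derivative is exactly u (- s u)^n / (1
    + s u); one integration adds an order. *)
Lemma Clog1p_expansion (u : C) (n : nat) :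
  bigO (S n) (fun s => Clog1p (s * u) - Csum (fun m => log_coef u m * s ^ m) n).
Proof.
  destruct (small_radius u) as (s0 & Hs0 & Hsmall).
  pose proof (Cmod_ge_0 u) as Hu.
  (* The 2 here bounds 1 / |1 + t u|; the one in 2 * K comes from [Cderive_bound]. *)
  set (K := (2 * Cmod u ^ S n)%R).
  assert (HK : (0 <= K)%R) by (unfold K; pose proof (pow_le _ (S n) Hu); lra).
  exists (2 * K)%R, s0.
  split; [lra | split; [lra | split; [lra |]]]; intros s Hs.
  set (f := fun s : R => Clog1p (s * u) - Csum (fun m => log_coef u m * s ^ m) n).
  assert (H0 : f 0%R = 0).
  { unfold f; rewrite Cmult_0_l, Clog1p_0, (Csum_ext _ (fun _ => 0 * 0)), Csum_scal; [ring |].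
    intros k _; destruct k; simpl; ring. }
  replace (Clog1p (s * u) - Csum (fun m => log_coef u m * s ^ m) n) with (f s - f 0%R)
    by (rewrite H0; unfold f; ring).
  eapply Rle_trans.
  - apply (Cderive_bound f (fun t => u * (- (t * u)) ^ n / (1 + t * u)) 0 s (K * s ^ n)); [lra |].
    intros t Ht; specialize (Hsmall t ltac:(lra)).
    assert (Hlow : (1 / 2 <= Cmod (1 + t * u))%R).
    { pose proof (Cmod_triangle (1 + t * u) (- (t * u))) as T.
      replace (1 + t * u + - (t * u)) with (RtoC 1) in T by ring.
      rewrite Cmod_1, Cmod_opp in T; lra. }
    assert (Hne : 1 + t * u <> 0) by (apply Cmod_gt_0; lra).
    split.
    + eapply is_Cderive_eq.
      * apply is_Cderive_minus.
        -- apply is_Cderive_Clog1p.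
           replace (t * Re u)%R with (Re (t * u)) by (destruct u; simpl; ring).
           apply Re_gt_m1, Hsmall.
        -- apply log_partial_derive.
      * destruct n as [| n]; [simpl; field; exact Hne |].
        rewrite Csum_scal.
        assert (G : Csum (Cpow (- (t * u))) n = (1 - (- (t * u)) ^ S n) / (1 + t * u)).
        { rewrite <- (Csum_geometric (- (t * u)) n).
          change (fun m => (- (t * u)) ^ m) with (Cpow (- (t * u))); field; exact Hne. }
        rewrite G; field; exact Hne.
    + rewrite Cmod_div, Cmod_mult, Cmod_pow, Cmod_opp, Cmod_mult, Cmod_R, Rabs_right by (assumption || lra).
      unfold K; rewrite Rpow_mult_distr.
      assert (Hi : (/ Cmod (1 + t * u) <= 2)%R).
      { replace 2%R with (/ (1 / 2))%R by field; apply Rinv_le_contravar; lra. }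
      assert (Ht' : (t ^ n <= s ^ n)%R) by (apply pow_incr; lra).
      assert (H1 : (0 <= Cmod u ^ S n)%R) by (apply pow_le, Hu).
      assert (H2 : (0 <= t ^ n)%R) by (apply pow_le; lra).
      assert (H3 : (0 < / Cmod (1 + t * u))%R) by (apply Rinv_0_lt_compat; lra).
      unfold Rdiv.
      replace (Cmod u * (t ^ n * Cmod u ^ n) * / Cmod (1 + t * u))%R
        with (Cmod u ^ S n * (/ Cmod (1 + t * u) * t ^ n))%R by (simpl; ring).
      rewrite (Rmult_comm 2), Rmult_assoc; apply Rmult_le_compat_l; [exact H1 |].
      apply Rmult_le_compat; lra.
  - apply Req_le; simpl; ring.
Qed.

(* [shift_coef j m] is the coefficient of s^m in (s / (1 + s))^j. *)
Fixpoint shift_coef (j m : nat) : R :=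
  match j with
  | O => match m with O => 1 | S _ => 0 end
  | S j' => (fix aux m := match m with O => 0 | S m' => shift_coef j' m' - aux m' end) m
  end%R.

Lemma shift_coef_0_S (m : nat) : shift_coef 0 (S m) = 0%R.
Proof. reflexivity. Qed.

Lemma shift_coef_S_0 (j : nat) : shift_coef (S j) 0 = 0%R.
Proof. reflexivity. Qed.

(** Coefficientwise form of (1 + s) (s / (1 + s))^(j+1) = s (s / (1 + s))^j. *)
Lemma shift_coef_S_S (j m : nat) :
  shift_coef (S j) (S m) = (shift_coef j m - shift_coef (S j) m)%R.
Proof. reflexivity. Qed.

Lemma shift_coef_small (j m : nat) : (m < j)%nat -> shift_coef j m = 0%R.
Proof.
  revert m; induction j as [| j IHj]; [lia |].
  induction m as [| m IHm]; intros Hm; [reflexivity |].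
  rewrite shift_coef_S_S, IHj, IHm by lia; ring.
Qed.

(** The binomial series of (1 + s)^(-j-1), by Pascal's rule; factorials are used to match those in
    [delta_recurrence]. *)
Lemma shift_coef_eq (j i : nat) :
  shift_coef (S j) (S (j + i)) =
    ((-1) ^ i * INR (fact (j + i)) / (INR (fact j) * INR (fact i)))%R.
Proof.
  revert i; induction j as [| j IHj]; intros i.
  - induction i as [| i IHi].
    + simpl; field.
    + rewrite shift_coef_S_S.
      replace (0 + S i)%nat with (S (0 + i)) by lia.
      rewrite IHi, shift_coef_0_S.
      pose proof (INR_fact_neq_0 i); pose proof (INR_fact_neq_0 (S i)); simpl (0 + i)%nat.
      simpl (fact 0); simpl (INR 1); simpl pow; field; auto.
  - induction i as [| i IHi].
    + rewrite shift_coef_S_S, Nat.add_0_r, (shift_coef_small (S (S j)) (S j)) by lia.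
      specialize (IHj O); rewrite Nat.add_0_r in IHj; rewrite IHj.
      pose proof (INR_fact_neq_0 j); pose proof (INR_fact_neq_0 (S j)).
      simpl (fact 0); simpl (INR 1); simpl pow; field; auto.
    + rewrite shift_coef_S_S.
      replace (S j + S i)%nat with (S (j + S i)) by lia.
      replace (S (S j + i)) with (S (j + S i)) in IHi by lia.
      rewrite IHj, IHi.
      replace (S j + i)%nat with (j + S i)%nat by lia.
      rewrite !(fact_simpl (j + S i)), !(fact_simpl j), !(fact_simpl i), !mult_INR.
      rewrite (S_INR (j + S i)), plus_INR, !S_INR.
      pose proof (INR_fact_neq_0 i); pose proof (INR_fact_neq_0 j).
      pose proof (pos_INR i); pose proof (pos_INR j).
      rewrite <- tech_pow_Rmult; field; repeat split; try lra.
Qed.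

(** Induction on j at fixed n: the truncations satisfy (1 + s) P_(j+1) = s P_j + d s^(n+1), so each
    step adds only one term of the admissible order. *)
Lemma shift_expansion (j n : nat) :
  bigO (S n) (fun s => (s / (1 + s)) ^ j - Csum (fun m => shift_coef j m * s ^ m) n).
Proof.
  induction j as [| j IH].
  - apply (bigO_ext (S n) (fun _ => 0) _ 1 Rlt_0_1); [| apply bigO_0].
    intros s _; destruct n; [rewrite Csum_O; simpl; ring |].
    rewrite Csum_S_l, (Csum_ext _ (fun _ => 0 * 0)), Csum_scal; [simpl; ring |].
    intros k _; rewrite shift_coef_0_S; ring.
  - destruct IH as (K & s0 & H0 & H1 & HK & H).
    set (d := (shift_coef (S j) n - shift_coef j n)%R).
    exists (K + Rabs d)%R, s0; pose proof (Rabs_pos d).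
    split; [exact H0 | split; [exact H1 | split; [lra |]]]; intros s Hs.
    specialize (H s Hs).
    assert (Hne : 1 + s <> 0) by (rewrite <- RtoC_plus; intros E; apply RtoC_inj in E; lra).
    assert (P : (1 + s) * Csum (fun m => shift_coef (S j) m * s ^ m) n =
       s * Csum (fun m => shift_coef j m * s ^ m) n + d * s ^ S n).
    { unfold d; clear; induction n as [| n IH].
      - rewrite !Csum_O, shift_coef_S_0, RtoC_minus; simpl; ring.
      - rewrite !Csum_S, !Cmult_plus_distr_l, IH, shift_coef_S_S, !RtoC_minus; simpl; ring. }
    set (X := (s / (1 + s)) ^ j - Csum (fun m => shift_coef j m * s ^ m) n) in *.
    replace ((s / (1 + s)) ^ S j - Csum (fun m => shift_coef (S j) m * s ^ m) n)
      with ((s * X - d * s ^ S n) / (1 + s)).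
    2:{ replace (Csum (fun m => shift_coef (S j) m * s ^ m) n) with
         ((s * Csum (fun m => shift_coef j m * s ^ m) n + d * s ^ S n) / (1 + s))
         by (rewrite <- P; field; exact Hne).
        unfold X; rewrite (Cpow_S (s / (1 + s)) j); field; exact Hne. }
    rewrite Cmod_div by exact Hne.
    rewrite <- RtoC_plus, Cmod_R, (Rabs_right (1 + s)) by lra.
    assert (Hb : (Cmod (s * X - d * s ^ S n) <= (K + Rabs d) * s ^ S n)%R).
    { eapply Rle_trans; [apply Cmod_triangle |].
      rewrite Cmod_opp, !Cmod_mult, <- RtoC_pow, !Cmod_R, (Rabs_right s) by lra.
      rewrite (Rabs_right (s ^ S n)) by (apply Rle_ge, pow_le; lra).
      assert (s * Cmod X <= 1 * (K * s ^ S n))%R.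
      { apply Rmult_le_compat; try lra; apply Cmod_ge_0. }
      lra. }
    eapply Rle_trans; [| exact Hb].
    unfold Rdiv.
    apply Rle_trans with (Cmod (s * X - d * s ^ S n) * 1)%R; [| lra].
    apply Rmult_le_compat_l; [apply Cmod_ge_0 |].
    rewrite <- Rinv_1; apply Rinv_le_contravar; lra.
Qed.

(** Puts s^j in the same form as the other truncated series, so that powers of s can be
    collected. *)
Lemma monomial_expansion (j n : nat) : (j <= n)%nat -> forall s : C,
  s ^ j = Csum (fun m => (if Nat.eqb m j then 1 else 0) * s ^ m) n.
Proof.
  intros Hj s; revert Hj.
  assert (Z : forall k, (k < j)%nat -> Csum (fun m => (if Nat.eqb m j then 1 else 0) * s ^ m) k = 0).
  { intros k Hk; rewrite (Csum_ext _ (fun _ => 0 * 0)), Csum_scal; [ring |].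
    intros i Hi; destruct (Nat.eqb_spec i j); [lia | ring]. }
  induction n as [| n IH]; intros Hj.
  - assert (j = O) by lia; subst; rewrite Csum_O; simpl; ring.
  - rewrite Csum_S; destruct (Nat.eqb_spec (S n) j) as [E | E].
    + rewrite Z, E by lia; ring.
    + rewrite <- IH by lia; ring.
Qed.

Lemma Csum_truncate (a : nat -> C) (m n : nat) : (m <= n)%nat ->
  (forall k, (m < k <= n)%nat -> a k = 0) -> Csum a n = Csum a m.
Proof.
  intros Hm; induction Hm as [| n Hm IH]; intros H; [reflexivity |].
  rewrite Csum_S, IH by (intros; apply H; lia); rewrite H by lia; ring.
Qed.

Lemma Csum_swap (a : nat -> nat -> C) (m n : nat) :
  Csum (fun i => Csum (fun j => a i j) n) m = Csum (fun j => Csum (fun i => a i j) m) n.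
Proof. apply (sum_n_switch (G := C_AbelianMonoid)). Qed.

(** By [bcoef_delta] this is b_(i+1), in terms of u and v alone. *)
Definition scaled_delta (B : nat -> C -> C) (u v : C) (i : nat) : C :=
  (- 1) ^ i * INR (fact i) * delta B u v (S (S i)).

Lemma Cpow_m1_add (i j : nat) : (- 1) ^ (i + j) = (- 1) ^ i * (- 1) ^ j :> C.
Proof. apply Cpow_add_r. Qed.

Lemma RtoC_shift_coef (i k : nat) :
  RtoC (shift_coef (S i) (S (i + k))) =
    (- 1) ^ k * INR (fact (i + k)) / (INR (fact i) * INR (fact k)).
Proof.
  rewrite shift_coef_eq, RtoC_div, !RtoC_mult, RtoC_pow; [reflexivity |].
  apply Rmult_integral_contrapositive; split; apply INR_fact_neq_0.
Qed.

(** The coefficient of s^m in [log_step]. At m = 1 the exponential factor cancels u + v; at m >= 2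
    the identity is [delta_recurrence]. *)
Lemma log_step_coef (B : nat -> C -> C) (HB : is_Bernoulli_polynomials B) (u v : C) (N m : nat) :
  (m <= S (S N))%nat ->
  log_coef u m + log_coef v m - (u + v) * (if Nat.eqb m 1 then 1 else 0)
  + Csum (fun i => scaled_delta B u v i
      * ((if Nat.eqb m (S i) then 1 else 0) - shift_coef (S i) m)) N = 0.
Proof.
  intros Hm; destruct m as [| [| m]].
  - rewrite (Csum_ext _ (fun _ => 0 * 0)), Csum_scal; [simpl; ring |].
    intros i _; rewrite shift_coef_S_0; simpl; ring.
  - rewrite (Csum_ext _ (fun _ => 0 * 0)), Csum_scal.
    + unfold log_coef; simpl; field.
    + intros i _; destruct i as [| i].
      * simpl; rewrite Rminus_0_r; ring.
      * rewrite (shift_coef_small (S (S i)) 1) by lia; simpl; ring.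
  (* Order m + 2 only sees i <= m: at i = m + 1 the two leading coefficients 1 cancel, and larger i
     start later. *)
  - assert (T : forall k, (m < k <= N)%nat -> scaled_delta B u v k
      * ((if Nat.eqb (S (S m)) (S k) then 1 else 0) - shift_coef (S k) (S (S m))) = 0).
    { intros k Hk; destruct (Nat.eqb_spec (S (S m)) (S k)) as [E | E].
      - assert (k = S m) by lia; subst k.
        pose proof (RtoC_shift_coef (S m) 0) as H; rewrite Nat.add_0_r in H; rewrite H.
        simpl (fact 0); simpl (INR 1); simpl Cpow; field; apply RtoC_fact_neq_0.
      - rewrite shift_coef_small by lia; ring. }
    rewrite (Csum_truncate _ m N) by (lia || exact T).
    (* The signs and factorials of [scaled_delta] and [shift_coef] combine into a factor independent
       of i. *)
    rewrite (Csum_ext _ (fun i => ((- 1) ^ S m * INR (fact (S m))) *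
      (- (delta B u v (S (S i)) / INR (fact (S m - i)))))).
    + rewrite Csum_scal.
      rewrite (Csum_ext _ (fun i => (- 1) * (delta B u v (S (S i)) / INR (fact (S m - i)))))
        by (intros; ring).
      rewrite Csum_scal, (delta_recurrence B HB).
      unfold log_coef; rewrite (fact_simpl (S m)), mult_INR, RtoC_mult; cbn [Nat.eqb].
      field; split; [apply RtoC_fact_neq_0 | apply RtoC_INR_S_neq_0].
    + intros i Hi; destruct (Nat.eqb_spec (S (S m)) (S i)); [lia |].
      unfold scaled_delta.
      replace (S m) with (i + (S m - i))%nat at 1 2 3 by lia.
      rewrite RtoC_shift_coef, Cpow_m1_add.
      field; split; apply RtoC_fact_neq_0.
Qed.

(** For s = 1 / (n + 1/2), s / (1 + s) is 1 / (n + 3/2), so the sum is a difference of consecutive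
    truncated series. *)
Lemma log_step (B : nat -> C -> C) (HB : is_Bernoulli_polynomials B) (u v : C) (N : nat) :
  bigO (S (S (S N))) (fun s => Clog1p (s * u) + Clog1p (s * v) - s * (u + v)
    + Csum (fun i => scaled_delta B u v i * (s ^ S i - (s / (1 + s)) ^ S i)) N).
Proof.
  set (n := S (S N)).
  apply (bigO_ext _ (fun s =>
    (Clog1p (s * u) - Csum (fun m => log_coef u m * s ^ m) n)
    + (Clog1p (s * v) - Csum (fun m => log_coef v m * s ^ m) n)
    + Csum (fun i => - scaled_delta B u v i
        * ((s / (1 + s)) ^ S i - Csum (fun m => shift_coef (S i) m * s ^ m) n)) N) _ 1 Rlt_0_1).
  2:{ apply bigO_plus; [apply bigO_plus; apply Clog1p_expansion |].
      apply (bigO_Csum _ N (fun i s => - scaled_delta B u v i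
        * ((s / (1 + s)) ^ S i - Csum (fun m => shift_coef (S i) m * s ^ m) n))).
      intros i; apply bigO_scal, shift_expansion. }
  intros s _.
  (* All polynomial parts gathered by powers of s; what follows only rearranges this zero sum. *)
  assert (Z : Csum (fun m => (log_coef u m + log_coef v m - (u + v) * (if Nat.eqb m 1 then 1 else 0)
      + Csum (fun i => scaled_delta B u v i
          * ((if Nat.eqb m (S i) then 1 else 0) - shift_coef (S i) m)) N) * s ^ m) n = 0).
  { rewrite (Csum_ext _ (fun _ => 0 * 0)), Csum_scal; [ring |].
    intros m Hm; rewrite (log_step_coef B HB) by exact Hm; ring. }
  rewrite (Csum_ext _ (fun m => (log_coef u m * s ^ m + log_coef v m * s ^ m)
      + (- (u + v) * ((if Nat.eqb m 1 then 1 else 0) * s ^ m)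
      + Csum (fun i => scaled_delta B u v i * ((if Nat.eqb m (S i) then 1 else 0) * s ^ m)
          + - scaled_delta B u v i * (shift_coef (S i) m * s ^ m)) N))) in Z.
  2:{ intros m _; rewrite !Cmult_plus_distr_r.
      rewrite (Cmult_comm (Csum _ N) (s ^ m)), <- Csum_scal.
      rewrite (Csum_ext (fun i => s ^ m * (scaled_delta B u v i
          * ((if Nat.eqb m (S i) then 1 else 0) - shift_coef (S i) m)))
        (fun i => scaled_delta B u v i * ((if Nat.eqb m (S i) then 1 else 0) * s ^ m)
          + - scaled_delta B u v i * (shift_coef (S i) m * s ^ m))) by (intros; ring).
      ring. }
  rewrite !Csum_plus, Csum_scal, <- (monomial_expansion 1 n ltac:(unfold n; lia)), Csum_swap in Z.
  match type of Z with _ + (_ + ?d) = _ =>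
    replace d with (Csum (fun i => scaled_delta B u v i * s ^ S i
     + - scaled_delta B u v i * Csum (fun m => shift_coef (S i) m * s ^ m) n) N) in Z end.
  2:{ apply Csum_ext; intros i Hi.
      rewrite Csum_plus, !Csum_scal, <- (monomial_expansion (S i) n) by (unfold n; lia).
      reflexivity. }
  rewrite (Csum_ext (fun i => - scaled_delta B u v i
        * ((s / (1 + s)) ^ S i - Csum (fun m => shift_coef (S i) m * s ^ m) n))
    (fun i => scaled_delta B u v i * (s ^ S i - (s / (1 + s)) ^ S i)
      + - (1) * (scaled_delta B u v i * s ^ S i
         + - scaled_delta B u v i * Csum (fun m => shift_coef (S i) m * s ^ m) n)))
    by (intros; ring).
  rewrite Csum_plus, Csum_scal.
  match type of Z with ?a + ?b + (?c + ?d) = _ =>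
    replace d with (- (a + b + c)) by (transitivity (a + b + (c + d) - (a + b + c)); [rewrite Z |]; ring) end.
  rewrite Cpow_1_r; ring.
Qed.

(** * The asymptotic expansion *)

Local Open Scope R_scope.

(** Makes tails of order k^(-m-1) telescope. It combines (x+1)^(m+1) - x^(m+1) >= x^m with x + 1 <=
    2 x, the source of the power of 2. *)
Lemma inv_pow_telescope (m k : nat) : (1 <= k)%nat ->
  / INR k ^ S (S m) <= 2 ^ S m * (/ INR k ^ S m - / INR (S k) ^ S m).
Proof.
  intros Hk; set (x := INR k).
  assert (Hx : 1 <= x) by (apply (le_INR 1); exact Hk).
  rewrite S_INR; fold x.
  assert (H1 : x ^ m <= (x + 1) ^ m) by (apply pow_incr; lra).
  assert (H2 : (x + 1) ^ S m <= 2 ^ S m * x ^ S m).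
  { rewrite <- Rpow_mult_distr; apply pow_incr; lra. }
  assert (P : forall i, 0 < x ^ i) by (intros; apply pow_lt; lra).
  assert (Q : forall i, 0 < (x + 1) ^ i) by (intros; apply pow_lt; lra).
  pose proof (P m); pose proof (P (S m)); pose proof (Q (S m)).
  replace (2 ^ S m * (/ x ^ S m - / (x + 1) ^ S m))
    with (2 ^ S m * ((x + 1) ^ S m - x ^ S m) / (x ^ S m * (x + 1) ^ S m))
    by (field; split; apply Rgt_not_eq; auto).
  apply Rmult_le_reg_r with (x ^ S m * (x + 1) ^ S m); [apply Rmult_lt_0_compat; auto |].
  replace (2 ^ S m * ((x + 1) ^ S m - x ^ S m) / (x ^ S m * (x + 1) ^ S m) * (x ^ S m * (x + 1) ^ S m))
    with (2 ^ S m * ((x + 1) ^ S m - x ^ S m)) by (field; split; apply Rgt_not_eq; auto).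
  replace (/ x ^ S (S m) * (x ^ S m * (x + 1) ^ S m)) with ((x + 1) ^ S m / x)
    by (simpl; field; split; [apply Rgt_not_eq; auto | lra]).
  apply Rle_trans with (2 ^ S m * x ^ m).
  - apply Rmult_le_reg_r with x; [lra |].
    replace ((x + 1) ^ S m / x * x) with ((x + 1) ^ S m) by (field; lra).
    eapply Rle_trans; [exact H2 |]; apply Req_le; simpl; ring.
  - apply Rmult_le_compat_l; [apply pow_le; lra |].
    simpl; nra.
Qed.

(* [- e k] is the tail of the series of the [l i], [i >= k]. *)
Lemma series_tail (l t : nat -> R) (n0 : nat) :
  (forall k, (n0 <= k)%nat -> Rabs (l k) <= t k - t (S k)) -> is_lim_seq t 0 ->
  exists e : nat -> R, forall k, (n0 <= k)%nat -> e (S k) = e k + l k /\ Rabs (e k) <= t k.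
Proof.
  intros Hl Ht.
  set (A := fun i => match i with O => 0 | S i' => sum_n (fun j => l (n0 + j)%nat) i' end).
  assert (AS : forall i, A (S i) = A i + l (n0 + i)%nat).
  { intros [| i]; unfold A; [rewrite sum_O; ring | rewrite sum_Sn; reflexivity]. }
  assert (Hb : forall i, - (t (n0 + i)%nat - t (n0 + S i)%nat) <= l (n0 + i)%nat
     <= t (n0 + i)%nat - t (n0 + S i)%nat).
  { intros i; apply Rabs_le_between.
    replace (n0 + S i)%nat with (S (n0 + i)) by lia; apply Hl; lia. }
  assert (Ht' : is_lim_seq (fun i => t (n0 + i)%nat) 0).
  { apply is_lim_seq_ext with (fun i => t (i + n0)%nat); [intros; f_equal; lia |].
    apply -> (is_lim_seq_incr_n t n0); exact Ht. }
  (* Partial sums minus and plus the tail bound are monotone with the same limit [a]; this yields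
     convergence and the bound on the tail together. *)
  set (lo := fun i => A i - t (n0 + i)%nat); set (hi := fun i => A i + t (n0 + i)%nat).
  assert (Hlo : forall i, lo i <= lo (S i)) by (intros i; unfold lo; rewrite AS; specialize (Hb i); lra).
  assert (Hhi : forall i, hi (S i) <= hi i) by (intros i; unfold hi; rewrite AS; specialize (Hb i); lra).
  assert (Hpos : forall i, 0 <= t (n0 + i)%nat).
  { intros i; apply (is_lim_seq_decr_compare (fun j => t (n0 + j)%nat) 0 Ht').
    intros j; specialize (Hb j); lra. }
  destruct (ex_finite_lim_seq_incr lo (hi O)) as [a Ha]; [exact Hlo | |].
  { assert (forall i, hi i <= hi O).
    { induction i as [| i IH]; [lra | specialize (Hhi i); lra]. }
    intros i; specialize (H i); specialize (Hpos i); unfold lo, hi in *; lra. }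
  assert (Ha' : is_lim_seq hi a).
  { apply is_lim_seq_ext with (fun i => lo i + 2 * t (n0 + i)%nat); [intros; unfold lo, hi; ring |].
    replace (Finite a) with (Finite (a + 2 * 0)) by (f_equal; ring).
    apply is_lim_seq_plus'; [exact Ha | apply is_lim_seq_mult'; [apply is_lim_seq_const | exact Ht']]. }
  exists (fun k => A (k - n0)%nat - a); intros k Hk.
  replace (S k - n0)%nat with (S (k - n0)) by lia; rewrite AS.
  replace (n0 + (k - n0))%nat with k by lia; split; [ring |].
  pose proof (is_lim_seq_incr_compare lo a Ha Hlo (k - n0)%nat) as L.
  pose proof (is_lim_seq_decr_compare hi a Ha' Hhi (k - n0)%nat) as H.
  unfold lo, hi in L, H; replace (n0 + (k - n0))%nat with k in * by lia.
  apply Rabs_le; lra.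
Qed.

Lemma is_lim_seq_inv_pow (c : R) (m : nat) : is_lim_seq (fun k => c * / INR k ^ S m) 0.
Proof.
  replace (Finite 0) with (Finite (c * 0)) by (f_equal; ring).
  apply is_lim_seq_mult'; [apply is_lim_seq_const |].
  apply is_lim_seq_ext_loc with (fun k => (/ INR k) ^ S m).
  { exists 1%nat; intros n Hn; apply pow_inv. }
  induction m as [| m IH].
  - apply is_lim_seq_ext with (fun k => / INR k); [intros; ring |].
    apply (is_lim_seq_inv _ p_infty); [apply is_lim_seq_INR | discriminate].
  - apply is_lim_seq_ext with (fun k => / INR k * (/ INR k) ^ S m); [reflexivity |].
    replace (Finite 0) with (Finite (0 * 0)) by (f_equal; ring).
    apply is_lim_seq_mult'; [| exact IH].
    apply (is_lim_seq_inv _ p_infty); [apply is_lim_seq_INR | discriminate].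
Qed.

Lemma Cseries_tail (l : nat -> C) (K : R) (m n0 : nat) : (1 <= n0)%nat -> 0 <= K ->
  (forall k, (n0 <= k)%nat -> Cmod (l k) <= K * / INR k ^ S (S m)) ->
  exists e : nat -> C, forall k, (n0 <= k)%nat ->
    e (S k) = (e k + l k)%C /\ Cmod (e k) <= 2 * (K * 2 ^ S m) * / INR k ^ S m.
Proof.
  intros Hn0 HK Hl.
  set (t := fun k => K * 2 ^ S m * / INR k ^ S m).
  assert (Ht : is_lim_seq t 0) by apply is_lim_seq_inv_pow.
  assert (Hb : forall k, (n0 <= k)%nat -> Cmod (l k) <= t k - t (S k)).
  { intros k Hk; eapply Rle_trans; [apply Hl, Hk |]; unfold t.
    rewrite <- Rmult_minus_distr_l, Rmult_assoc.
    apply Rmult_le_compat_l; [exact HK | apply inv_pow_telescope; lia]. }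
  destruct (series_tail (fun k => Re (l k)) t n0) as [e1 H1]; [| exact Ht |].
  { intros k Hk; eapply Rle_trans; [apply re_le_Cmod | apply Hb, Hk]. }
  destruct (series_tail (fun k => Im (l k)) t n0) as [e2 H2]; [| exact Ht |].
  { intros k Hk; eapply Rle_trans; [apply im_le_Cmod | apply Hb, Hk]. }
  exists (fun k => (e1 k, e2 k)); intros k Hk.
  destruct (H1 k Hk) as [E1 B1], (H2 k Hk) as [E2 B2]; split.
  - apply C_ext; simpl; [rewrite E1 | rewrite E2]; reflexivity.
  - eapply Rle_trans; [apply Cmod_le_Re_Im |]; simpl Re; simpl Im; unfold t in *; lra.
Qed.

Local Open Scope C_scope.

(** With d = 2 / s, the quadratic factor is (1 + s u) (1 + s v) and p / d is s (u + v). *)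
Lemma Rfactor_exp (p q u v : C) (s : R) : (0 < s)%R -> u + v = p / 2 -> u * v = q / 4 ->
  (Cmod (s * u) <= 1 / 2)%R -> (Cmod (s * v) <= 1 / 2)%R ->
  Rfactor p q (2 / s) = Cexp (Clog1p (s * u) + Clog1p (s * v) - s * (u + v)).
Proof.
  intros Hs Hsum Hprod Hu Hv.
  assert (HsC : RtoC s <> 0) by (intros E; apply RtoC_inj in E; lra).
  replace p with (2 * (u + v)) by (rewrite Hsum; field).
  replace q with (4 * (u * v)) by (rewrite Hprod; field).
  unfold Cminus; rewrite !Cexp_plus, !Cexp_Clog1p by (apply Re_gt_m1; assumption).
  unfold Rfactor; rewrite RtoC_div by lra.
  replace (- (2 * (u + v)) / (2 / s)) with (- (s * (u + v))) by (field; exact HsC).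
  field; exact HsC.
Qed.

Lemma Rprod_asymptotic (B : nat -> C -> C) (p q Delta : C)
    (HB : is_Bernoulli_polynomials B)
    (HDelta : Delta ^ 2 = p ^ 2 - 4 * q) :
  exp_asymptotic (Rprod p q) (Rconst p Delta) (bcoef B p q Delta).
Proof.
  intros N HN; destruct N as [| N]; [lia | clear HN].
  set (u := p / 4 + Delta / 4); set (v := p / 4 - Delta / 4).
  assert (Hsum : u + v = p / 2) by (unfold u, v; field).
  assert (Hprod : u * v = q / 4).
  { replace q with ((p ^ 2 - Delta ^ 2) / 4) by (rewrite HDelta; field); unfold u, v; field. }
  destruct (small_radius u) as (r1 & Hr1 & Hu), (small_radius v) as (r2 & Hr2 & Hv).
  destruct (log_step B HB u v N) as (K & r3 & Hr3 & _ & HK & HL).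
  set (r := Rmin r1 (Rmin r2 r3)).
  assert (Hr : (0 < r)%R) by (unfold r; repeat apply Rmin_pos; lra).
  assert (Hrr : (r <= r1 /\ r <= r2 /\ r <= r3)%R).
  { unfold r; pose proof (Rmin_l r1 (Rmin r2 r3)); pose proof (Rmin_r r1 (Rmin r2 r3)).
    pose proof (Rmin_l r2 r3); pose proof (Rmin_r r2 r3); lra. }
  set (s := fun n : nat => (/ (INR n + 1 / 2))%R).
  set (S0 := fun n : nat => Csum (fun i => scaled_delta B u v i * s n ^ S i) N).
  (* The defect of the telescoping at step n, a summable quantity. *)
  set (L := fun n => Clog1p (s n * u) + Clog1p (s n * v) - s n * (u + v) + S0 n - S0 (S n)).
  assert (Hs : forall n, (0 < s n)%R).
  { intros n; apply Rinv_0_lt_compat; pose proof (pos_INR n); lra. }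
  assert (Hs' : forall n, RtoC (s (S n)) = s n / (1 + s n)).
  { intros n; specialize (Hs n); pose proof (pos_INR n).
    rewrite <- RtoC_plus, <- RtoC_div by lra; f_equal.
    unfold s; rewrite S_INR; field; lra. }
  (* From n1 + 1 on, [s n] lies in the range of validity of all three local estimates. *)
  destruct (nfloor_ex (/ r)) as [n1 Hn1]; [left; apply Rinv_0_lt_compat, Hr |].
  set (n0 := S n1).
  assert (Hsr : forall n, (n0 <= n)%nat -> (s n <= r)%R /\ (s n <= / INR n)%R).
  { intros n Hn; apply le_INR in Hn; unfold n0 in Hn; rewrite S_INR in Hn.
    pose proof (Rinv_0_lt_compat _ Hr).
    split; [rewrite <- (Rinv_inv r) |]; apply Rinv_le_contravar; lra. }
  assert (Hstep : forall n, (n0 <= n)%nat -> Rprod p q (S n) = Rprod p q n * Cexp (L n - S0 n + S0 (S n))).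
  { intros n Hn; destruct (Hsr n Hn) as [H1 _]; specialize (Hs n).
    rewrite Rprod_S; f_equal.
    replace (2 * INR n + 1)%R with (2 / s n)%R by (unfold s; pose proof (pos_INR n); field; lra).
    rewrite (Rfactor_exp p q u v) by (try apply Hu; try apply Hv; lra || assumption).
    f_equal; unfold L; ring. }
  assert (HLb : forall n, (n0 <= n)%nat -> (Cmod (L n) <= K * / INR n ^ S (S (S N)))%R).
  { intros n Hn; destruct (Hsr n Hn) as [H1 H2]; specialize (Hs n).
    replace (L n) with (Clog1p (s n * u) + Clog1p (s n * v) - s n * (u + v)
      + Csum (fun i => scaled_delta B u v i * (s n ^ S i - (s n / (1 + s n)) ^ S i)) N).
    - eapply Rle_trans; [apply HL; lra |].
      apply Rmult_le_compat_l; [exact HK |].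
      rewrite <- pow_inv; apply pow_incr; lra.
    - unfold L, S0; rewrite (Csum_ext _ (fun i => scaled_delta B u v i * s n ^ S i
        + (- 1) * (scaled_delta B u v i * s (S n) ^ S i)))
        by (intros; rewrite Hs'; ring).
      rewrite Csum_plus, Csum_scal; ring. }
  destruct (Cseries_tail L K (S N) n0) as [e He]; [unfold n0; lia | exact HK | exact HLb |].
  set (M := (2 * (K * 2 ^ S (S N)))%R) in *.
  (* The product stripped of the expansion and of the error: constant from n0 on, possibly 0. *)
  set (G := fun n => Rprod p q n * Cexp (- (S0 n + e n))).
  assert (HG : forall n, (n0 <= n)%nat -> G n = G n0).
  { intros n Hn; induction Hn as [| n Hn IH]; [reflexivity |].
    rewrite <- IH; unfold G; rewrite Hstep, (proj1 (He n Hn)), <- Cmult_assoc, <- Cexp_plus by exact Hn.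
    do 2 f_equal; ring. }
  assert (HF : forall n, (n0 <= n)%nat -> Rprod p q n = G n0 * Cexp (S0 n + e n)).
  { intros n Hn; rewrite <- (HG n Hn); unfold G.
    rewrite <- Cmult_assoc, <- Cexp_plus.
    replace (- (S0 n + e n) + (S0 n + e n)) with (RtoC 0) by ring; rewrite Cexp_0; ring. }
  assert (Le : is_Clim e 0).
  { apply is_Clim_bound with (fun k => (M * / INR k ^ S (S N))%R); [| apply is_lim_seq_inv_pow].
    exists n0; intros n Hn; replace (e n - 0) with (e n) by ring; apply He, Hn. }
  assert (Ls : is_Clim (fun n => RtoC (s n)) 0).
  { apply is_Clim_RtoC.
    apply (is_lim_seq_inv (fun n => INR n + 1 / 2)%R p_infty); [| discriminate].
    apply (is_lim_seq_plus _ _ p_infty (1 / 2)%R);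
      [apply is_lim_seq_INR | apply is_lim_seq_const | reflexivity]. }
  assert (LS : is_Clim S0 0).
  { assert (T : forall i, is_Clim (fun n => scaled_delta B u v i * s n ^ S i) 0).
    { intros i; replace (RtoC 0) with (scaled_delta B u v i * 0) by ring.
      apply is_Clim_mult; [apply is_Clim_const |].
      induction i as [| i IH].
      - apply is_Clim_ext with (fun n => RtoC (s n)); [intros; ring | exact Ls].
      - replace (RtoC 0) with (0 * 0) by ring.
        apply (is_Clim_mult (fun n => RtoC (s n)) (fun n => s n ^ S i)); assumption. }
    unfold S0; clearbody M; clear - T; induction N as [| N IH].
    - apply is_Clim_ext with (fun n => scaled_delta B u v 0 * s n ^ 1);
        [intros n; rewrite Csum_O; reflexivity | apply T].
    - apply is_Clim_ext with (fun n => Csum (fun i => scaled_delta B u v i * s n ^ S i) N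
        + scaled_delta B u v (S N) * s n ^ S (S N)); [intros n; rewrite Csum_S; reflexivity |].
      replace (RtoC 0) with (0 + 0) by ring; apply is_Clim_plus; [exact IH | apply T]. }
  (* The exponents tend to 0, so this constant is the limit of the product. *)
  assert (Hconst : G n0 = Rconst p Delta).
  { apply (is_Clim_unique (Rprod p q)); [| apply Rprod_limit, HDelta].
    apply is_Clim_ext_loc with (fun n => G n0 * Cexp (S0 n + e n)).
    - exists n0; intros n Hn; symmetry; apply HF, Hn.
    - assert (X : is_Clim (fun n => G n0 * Cexp (S0 n + e n)) (G n0 * Cexp (0 + 0))).
      { apply is_Clim_mult; [apply is_Clim_const |].
        apply is_Clim_Cexp, is_Clim_plus; assumption. }
      replace (0 + 0) with (RtoC 0) in X by ring.
      rewrite Cexp_0, Cmult_1_r in X; exact X. }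
  exists e, M, n0; intros n Hn; split.
  - replace (S N + 1)%nat with (S (S N)) by lia; apply He, Hn.
  - rewrite (HF n Hn), Hconst; do 3 f_equal.
    unfold S0, Csum, sum_n; rewrite <- sum_n_m_S.
    apply (sum_n_m_ext (G := C_AbelianMonoid)); intros i.
    rewrite (bcoef_delta B HB p q Delta HDelta); fold u v; unfold scaled_delta, s.
    assert (Hx : (INR n + 1 / 2 <> 0)%R) by (pose proof (pos_INR n); lra).
    rewrite RtoC_inv, RtoC_plus, RtoC_div by lra; unfold Cdiv at 3.
    rewrite Cpow_inv; [reflexivity |].
    rewrite <- RtoC_div, <- RtoC_plus by lra; intros E; apply RtoC_inj in E; lra.
Qed.

Theorem theorem2p2 (B : nat -> C -> C) (p q Delta : C)
    (HB : is_Bernoulli_polynomials B)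
    (HDelta : Delta ^ 2 = p ^ 2 - 4 * q) :
  exp_asymptotic (Rprod p q) (Rconst p Delta) (bcoef B p q Delta)
  /\
  bcoef B p q Delta 1 = p ^ 2 / 8 - q / 4
  /\
  bcoef B p q Delta 2 =
    - p ^ 3 / 48 + p * q / 16 + p ^ 2 / 16 - q / 8
  /\
  bcoef B p q Delta 3 =
    p ^ 4 / 192 - p ^ 2 * q / 48 + q ^ 2 / 96
    - p ^ 3 / 48 + p * q / 16 + p ^ 2 / 48 - q / 24.
Proof.
  split; [exact (Rprod_asymptotic B p q Delta HB HDelta) |].
  split; [reflexivity | exact (bcoef_values B HB p q Delta HDelta)].
Qed.
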